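(* For every $\epsilon>0$ and positive integer $r$ there is a positive integer $N(r,\epsilon)$ such that the following holds. For every $N\ge N(r,\epsilon)$, if $G$ is an abelian group of odd order $N$ or $G=[N]=\{1,\dots,N\}$, and $A\subseteq G$ has density $\alpha=|A|/N$, then there exist $d_1,\dots,d_r$ (in $G$, resp. in $\mathbb{Z}$) such that the 3-boxes of dimension $r$ with common differences $d_1,\dots,d_r$ are proper, and the number of initial terms $a_0$ for which the 3-box with initial term $a_0$ and common differences $d_1,\dots,d_r$ is contained in $A$ is at least $(\alpha^{3^r}-\epsilon)N$.
   Context: A 3-box of dimension $r$ with initial term $a_0$ and common differences $d_1,\dots,d_r$ is the set $\{a_0+i_1d_1+\cdots+i_rd_r: i_j\in\{0,1,2\}\text{ for }1\le j\le r\}$ (computed in $G$, or in $\mathbb{Z}$ when $G=[N]$). It is proper if its $3^r$ listed elements are distinct, i.e. the sums $i_1d_1+\cdots+i_rd_r$ with $i_j\in\{0,1,2\}$ are pairwise distinct. *)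

(* Defs.v *)
From HB Require Import structures.
From mathcomp Require Import all_boot all_order all_algebra.
Set Implicit Arguments. Unset Strict Implicit. Unset Printing Implicit Defensive.
Import Order.TTheory GRing.Theory Num.Theory.
Local Open Scope ring_scope.

Definition boxidx (r : nat) := {ffun 'I_r -> 'I_3}.

Definition boxsum (V : zmodType) (r : nat) (d : 'I_r -> V) (i : boxidx r) : V :=
  \sum_(j < r) d j *+ i j.

Definition proper_box (V : zmodType) (r : nat) (d : 'I_r -> V) : Prop :=
  injective (boxsum d).

Definition box_in (V : zmodType) (r : nat) (d : 'I_r -> V) (A : pred V) (a0 : V) : bool :=
  [forall i : boxidx r, A (a0 + boxsum d i)].

(* Main.v *)
Require Import Defs.
From HB Require Import structures.
From mathcomp Require Import all_boot all_order all_algebra.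
From mathcomp Require Import ring lra zify.
Set Implicit Arguments. Unset Strict Implicit. Unset Printing Implicit Defensive.
Import Order.TTheory GRing.Theory Num.Theory.
Local Open Scope ring_scope.

(* For one common difference this is Green's popular difference theorem with boundedly many
   differences excluded, proved here without Fourier analysis.  Let [f] be the indicator of
   [A] and [F] its autocorrelation.  The almost periods of [F] in L1 play the role of Bohr
   sets: by random sampling (Croot-Sisask) they are dense, and they are the balls of a
   subadditive length [w].  Averaging [f] over a ball of radius [r] gives a function [s]
   almost invariant under much shorter shifts, and an energy increment yields radii
   [r' << rho << r] for which the averages [s] and [t] at [r] and [r'] are close in L2.
   Then [f - t] has tiny autocorrelation and does not affect the count of progressions with
   difference [a + b], [a] and [b] in the [rho]-ball, while [s] contributes at least
   [avg s ^ 3].  The weight on each difference is O(1/N), so boundedly many can be avoided.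
   For [N] one works modulo an odd [M] in [N, N + 1], with the distance to 0 on the circle
   added to [w] so that almost no progression wraps around.  A box is built one difference
   at a time, each time applied to the set of initial terms found so far; properness
   excludes at most [2 * 9 ^ r] values. *)

(** * Averages over a finite set, in L1 and L2 *)

Section Average.
Variables (R : realFieldType) (T : finType).
Hypothesis T0 : (0 < #|T|)%N.
Implicit Types f g : T -> R.

Definition avg f : R := (\sum_x f x) / #|T|%:R.

Lemma card_gt0R : 0 < #|T|%:R :> R. Proof. by rewrite ltr0n. Qed.

Lemma eq_avg f g : f =1 g -> avg f = avg g.
Proof. by move=> fg; rewrite /avg (eq_bigr _ (fun i _ => fg i)). Qed.

Lemma avgD f g : avg (fun x => f x + g x) = avg f + avg g.
Proof. by rewrite /avg big_split mulrDl. Qed.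

Lemma avgN f : avg (fun x => - f x) = - avg f.
Proof. by rewrite /avg sumrN mulNr. Qed.

Lemma avgB f g : avg (fun x => f x - g x) = avg f - avg g.
Proof. by rewrite avgD avgN. Qed.

Lemma avgZ c f : avg (fun x => c * f x) = c * avg f.
Proof. by rewrite /avg -mulr_sumr mulrA. Qed.

Lemma avgZr c f : avg (fun x => f x * c) = avg f * c.
Proof. by rewrite mulrC -avgZ; apply: eq_avg => x; rewrite mulrC. Qed.

Lemma avg_cst c : avg (fun=> c) = c.
Proof.
by rewrite /avg sumr_const -[RHS](mulfK (lt0r_neq0 card_gt0R)) mulr_natr.
Qed.

Lemma le_avg f g : (forall x, f x <= g x) -> avg f <= avg g.
Proof.
move=> fg; rewrite /avg ler_pM2r ?invr_gt0 ?card_gt0R //.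
by apply: ler_sum => x _; apply: fg.
Qed.

Lemma avg_ge0 f : (forall x, 0 <= f x) -> 0 <= avg f.
Proof. by move=> f0; rewrite -(avg_cst 0); apply: le_avg. Qed.

Lemma avg_le_cst f c : (forall x, f x <= c) -> avg f <= c.
Proof. by move=> fc; rewrite -[leRHS]avg_cst; apply: le_avg. Qed.

Lemma norm_avg f : `|avg f| <= avg (fun x => `|f x|).
Proof.
rewrite /avg normrM normfV (ger0_norm (ltW card_gt0R)).
by rewrite ler_pM2r ?invr_gt0 ?card_gt0R // ler_norm_sum.
Qed.

Lemma avg_inj (h : T -> T) f : injective h -> avg (fun x => f (h x)) = avg f.
Proof. by move=> hi; rewrite /avg [in RHS](reindex_inj hi). Qed.

Lemma sqr_avg_le f : avg f ^+ 2 <= avg (fun x => f x ^+ 2).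
Proof.
have : 0 <= avg (fun x => (f x - avg f) ^+ 2).
  by apply: avg_ge0 => x; apply: sqr_ge0.
suff -> : avg (fun x => (f x - avg f) ^+ 2) = avg (fun x => f x ^+ 2) - avg f ^+ 2.
  by rewrite subr_ge0.
transitivity (avg (fun x => f x ^+ 2 + ((- 2 * avg f) * f x + avg f ^+ 2))).
  by apply: eq_avg => x; ring.
by rewrite avgD avgD avgZ avg_cst; ring.
Qed.

(* Pointwise AM-GM [2 `|f| l <= f ^+ 2 + l ^+ 2] replaces Cauchy-Schwarz, as [R] has no square roots. *)
Lemma avg_norm_le f (l : R) : 0 < l -> avg (fun x => f x ^+ 2) <= l ^+ 2 ->
  avg (fun x => `|f x|) <= l.
Proof.
move=> l0 fl.
have : avg (fun x => (2 * l) * `|f x|) <= avg (fun x => f x ^+ 2 + l ^+ 2).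
  apply: le_avg => x; rewrite -(real_normK (num_real (f x))).
  have := sqr_ge0 (`|f x| - l); lra.
rewrite avgZ avgD avg_cst => h.
have : (2 * l) * avg (fun x => `|f x|) <= (2 * l) * l by lra.
by rewrite ler_pM2l // mulr_gt0.
Qed.

End Average.

Lemma exchange_avg (R : realFieldType) (S T : finType) (f : S -> T -> R) :
  avg (fun x => avg (fun y => f x y)) = avg (fun y => avg (fun x => f x y)).
Proof.
rewrite /avg -mulr_suml -mulr_suml exchange_big /= -!mulrA.
by rewrite [X in _ * X]mulrC.
Qed.

(** * Weights, averaging operators and autocorrelation on a finite abelian group *)

Section Group.
Variables (R : realFieldType) (G : finZmodType).
Implicit Types (f g h mu nu : G -> R) (x y a b d : G).

Lemma card_zmod_gt0 : (0 < #|G|)%N.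
Proof. by apply/card_gt0P; exists 0. Qed.
Let G0 := card_zmod_gt0.

Lemma avg_shift d f : avg (fun x => f (x + d)) = avg f.
Proof. by apply: avg_inj; apply: addIr. Qed.

(** A probability density for the normalized counting measure, so single values may be as large as
    [#|G|]. *)
Definition weight mu := (forall x, 0 <= mu x) /\ avg mu = 1.

Definition conv mu f x := avg (fun y => mu y * f (x + y)).

Lemma eq_conv mu f g : f =1 g -> conv mu f =1 conv mu g.
Proof. by move=> fg x; apply: eq_avg => y; rewrite fg. Qed.

Lemma convB mu f g x : conv mu (fun x => f x - g x) x = conv mu f x - conv mu g x.
Proof. by rewrite /conv -avgB; apply: eq_avg => y; rewrite mulrBr. Qed.

Lemma conv_shift mu f d x : conv mu (fun x => f (x + d)) x = conv mu f (x + d).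
Proof. by apply: eq_avg => y; rewrite addrAC. Qed.

Lemma wavg_cst mu c : weight mu -> avg (fun x => mu x * c) = c.
Proof. by move=> [_ m1]; rewrite avgZr m1 mul1r. Qed.

Lemma wavg_le mu f c : weight mu -> (forall x, mu x != 0 -> f x <= c) ->
  avg (fun x => mu x * f x) <= c.
Proof.
move=> wm fc; rewrite -[leRHS](wavg_cst _ wm); apply: le_avg => // x.
have [->|m0] := eqVneq (mu x) 0; first by rewrite !mul0r.
by apply: ler_wpM2l; [apply: wm.1 | apply: fc].
Qed.

Lemma wavg_ge mu f c : weight mu -> (forall x, mu x != 0 -> c <= f x) ->
  c <= avg (fun x => mu x * f x).
Proof.
move=> wm fc; rewrite -[leLHS](wavg_cst _ wm); apply: le_avg => // x.
have [->|m0] := eqVneq (mu x) 0; first by rewrite !mul0r.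
by apply: ler_wpM2l; [apply: wm.1 | apply: fc].
Qed.

Lemma avg_conv mu f : weight mu -> avg (conv mu f) = avg f.
Proof.
move=> wm; rewrite /conv exchange_avg.
rewrite -[RHS](wavg_cst _ wm); apply: eq_avg => y.
by rewrite avgZ avg_shift.
Qed.

Lemma norm_conv mu f x : weight mu -> `|conv mu f x| <= conv mu (fun x => `|f x|) x.
Proof.
move=> wm; apply: le_trans (norm_avg G0 _) _; apply: le_avg => // y.
by rewrite normrM (ger0_norm (wm.1 y)).
Qed.

Lemma avg_norm_conv mu f : weight mu ->
  avg (fun x => `|conv mu f x|) <= avg (fun x => `|f x|).
Proof.
move=> wm; rewrite -[leRHS](avg_conv _ wm); apply: le_avg => // x.
exact: norm_conv.
Qed.

Lemma avg_sqr_conv mu f : weight mu ->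
  avg (fun x => conv mu f x ^+ 2) <= avg (fun x => f x ^+ 2).
Proof.
move=> wm; rewrite -[leRHS](avg_conv _ wm); apply: le_avg => // x.
set m := conv mu f x.
have : 0 <= avg (fun y => mu y * (f (x + y) - m) ^+ 2).
  by apply: avg_ge0 => // y; rewrite mulr_ge0 ?sqr_ge0 ?wm.1.
suff -> : avg (fun y => mu y * (f (x + y) - m) ^+ 2) =
   conv mu (fun x => f x ^+ 2) x - m ^+ 2 by rewrite subr_ge0.
transitivity (avg (fun y => mu y * f (x + y) ^+ 2 +
   ((- 2 * m) * (mu y * f (x + y)) + mu y * m ^+ 2))).
  by apply: eq_avg => y; ring.
by rewrite avgD avgD avgZ wavg_cst // -/(conv mu f x) -/m /conv; ring.
Qed.

Lemma conv_selfadj mu f g : (forall x, mu (- x) = mu x) ->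
  avg (fun x => conv mu f x * g x) = avg (fun x => f x * conv mu g x).
Proof.
move=> ms.
transitivity (avg (fun y => mu y * avg (fun x => f (x + y) * g x))).
  transitivity (avg (fun x => avg (fun y => mu y * (f (x + y) * g x)))).
    by apply: eq_avg => x; rewrite -avgZr; apply: eq_avg => y; rewrite mulrA.
  by rewrite exchange_avg; apply: eq_avg => y; rewrite avgZ.
rewrite -(avg_inj (h := -%R)); last exact: oppr_inj.
transitivity (avg (fun x => avg (fun y => f x * (mu y * g (x + y))))); last first.
  by apply: eq_avg => x; rewrite avgZ.
rewrite exchange_avg; apply: eq_avg => y; rewrite ms -avgZ.
rewrite -(avg_shift y); apply: eq_avg => x.
by rewrite addrK mulrCA.
Qed.

Lemma conv_near mu f x k : weight mu ->
  (forall y, mu y != 0 -> `|f (x + y) - f x| <= k) -> `|conv mu f x - f x| <= k.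
Proof.
move=> wm near; have -> : conv mu f x - f x = avg (fun y => mu y * (f (x + y) - f x)).
  rewrite -[X in _ - X](wavg_cst _ wm) /conv -avgB.
  by apply: eq_avg => y; rewrite mulrBr.
apply: le_trans (norm_avg G0 _) _.
rewrite (eq_avg (g := fun y => mu y * `|f (x + y) - f x|)); last first.
  by move=> y; rewrite normrM (ger0_norm (wm.1 y)).
exact: wavg_le.
Qed.

(** A change of variable moves the shift from [f] to [mu]; [f] then enters only through its sup
    bound. *)
Lemma conv_inv mu f d x : (forall x, `|f x| <= 1) ->
  `|conv mu f (x + d) - conv mu f x| <= avg (fun y => `|mu (y + d) - mu y|).
Proof.
move=> f1; have -> : conv mu f (x + d) - conv mu f x =
    avg (fun y => (mu (y - d) - mu y) * f (x + y)).
  rewrite (eq_avg (g := fun y => mu (y - d) * f (x + y) - mu y * f (x + y))); last first.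
    by move=> y; rewrite mulrBl.
  rewrite avgB; congr (_ - _); rewrite -[RHS](avg_shift d).
  by apply: eq_avg => y; rewrite addrK addrAC addrA.
apply: le_trans (norm_avg G0 _) _.
rewrite -[leRHS](avg_shift (- d)); apply: le_avg => // y.
rewrite /= subrK normrM distrC.
by rewrite -[leRHS]mulr1 ler_wpM2l // ?f1.
Qed.

Definition autocorr f d := avg (fun y => f y * f (y + d)).

(* Two averages over [a] and [b] against the separated factors [p] and [q] see only the
   L1 norm of the autocorrelation of [g]: one Cauchy-Schwarz in [a] removes [p]. *)
Lemma bilinear_bound (p q g : G -> R) (ph ps : G -> G) K :
  injective ph -> injective ps ->
  (forall a, `|p a| <= K) -> (forall b, `|q b| <= K) ->
  avg (fun a => avg (fun b => p a * q b * g (ph a + ps b))) ^+ 2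
    <= K ^+ 4 * avg (fun d => `|autocorr g d|).
Proof.
move=> phI psI pK qK.
have K0 : 0 <= K by apply: le_trans (normr_ge0 _) (pK 0).
pose J a := avg (fun b => q b * g (ph a + ps b)).
have -> : avg (fun a => avg (fun b => p a * q b * g (ph a + ps b))) =
          avg (fun a => p a * J a).
  by apply: eq_avg => a; rewrite -avgZ; apply: eq_avg => b; rewrite mulrA.
apply: le_trans (sqr_avg_le G0 _) _.
apply: (@le_trans _ _ (K ^+ 2 * avg (fun a => J a ^+ 2))).
  rewrite -avgZ; apply: le_avg => // a; rewrite exprMn.
  apply: ler_wpM2r; first exact: sqr_ge0.
  by rewrite -(real_normK (num_real (p a))) lerXn2r ?nnegrE.
rewrite (exprD _ 2 2) -mulrA ler_wpM2l ?sqr_ge0 //.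
have -> : avg (fun a => J a ^+ 2) =
  avg (fun b => avg (fun b' => q b * q b' * autocorr g (ps b' - ps b))).
  transitivity (avg (fun a => avg (fun b => avg (fun b' =>
      q b * q b' * (g (ph a + ps b) * g (ph a + ps b')))))).
    apply: eq_avg => a; rewrite expr2 {1}/J -avgZr; apply: eq_avg => b.
    by rewrite -avgZ; apply: eq_avg => b'; ring.
  rewrite exchange_avg; apply: eq_avg => b.
  rewrite exchange_avg; apply: eq_avg => b'; rewrite avgZ; congr (_ * _).
  rewrite (avg_inj (fun x => g (x + ps b) * g (x + ps b')) phI).
  rewrite /autocorr -[RHS](avg_shift (ps b)); apply: eq_avg => x.
  by rewrite -addrA [ps b + _]addrC subrK.
apply: le_trans (ler_norm _) _; apply: le_trans (norm_avg G0 _) _.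
apply: avg_le_cst => // b; apply: le_trans (norm_avg G0 _) _.
have hI : injective (fun b' => ps b' - ps b) by move=> x y /addIr /psI.
rewrite -(avg_inj (fun d => `|autocorr g d|) hI) -avgZ; apply: le_avg => // b'.
rewrite [in leLHS]normrM; apply: ler_wpM2r => //.
by rewrite normrM expr2 ler_pM.
Qed.

End Group.

(** * Length functions, their balls, and weighted counts of progressions *)

Section Length.
Variables (R : realFieldType) (G : finZmodType).
Implicit Types (f g h mu nu w : G -> R) (x y a b d : G).
Let G0 := card_zmod_gt0 G.

Definition length_fun w :=
  [/\ forall x, 0 <= w x, forall x, w (- x) = w x
    & forall x y, w (x + y) <= w x + w y].

Definition ball w (r : R) := [set x | w x <= r].

Definition dens (S : {set G}) : R := #|S|%:R / #|G|%:R.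

(** A tent instead of an indicator: it is 1-Lipschitz for [w], so short shifts change it little. *)
Definition bump w (r : R) x := Num.max 0 (r - w x).

Definition bump_weight w r x := bump w r x / avg (bump w r).

Definition ball_weight w r x := (x \in ball w r)%:R / dens (ball w r).

Lemma dens_avg (S : {set G}) : dens S = avg (fun x => (x \in S)%:R).
Proof. by rewrite /dens /avg -natr_sum -sum1_card big_mkcond. Qed.

Lemma ball_weightP w r : 0 < dens (ball w r) -> weight (ball_weight w r).
Proof.
move=> d0; split=> [x|]; first by rewrite mulr_ge0 ?ler0n // invr_ge0 ltW.
by rewrite avgZr -dens_avg divff // gt_eqF.
Qed.

Lemma ball_weight_supp w r x : ball_weight w r x != 0 -> w x <= r.
Proof. by rewrite /ball_weight inE; case: (_ <= _) => //; rewrite mul0r eqxx. Qed.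

Lemma ball_weight_le w r x c : 0 < c -> c <= dens (ball w r) ->
  ball_weight w r x <= c^-1.
Proof.
move=> c0 cd; have d0 := lt_le_trans c0 cd.
rewrite /ball_weight; apply: (@le_trans _ _ (dens (ball w r))^-1).
  by rewrite -[leRHS]mul1r ler_pM2r ?invr_gt0 //; case: (_ \in _); rewrite ?lexx ?ler01.
by rewrite lef_pV2.
Qed.

(** On the ball of half the radius the tent is at least [r / 2]. *)
Lemma avg_bump_ge w r : 0 <= r -> r / 2 * dens (ball w (r / 2)) <= avg (bump w r).
Proof.
move=> r0; rewrite dens_avg -avgZ; apply: le_avg => // x; rewrite inE /bump le_max.
case: (boolP (w x <= r / 2)) => wx; last by rewrite mulr0 lexx.
by apply/orP; right; rewrite mulr1; lra.
Qed.

Section Bump.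
Variables (w : G -> R) (r : R).
Hypotheses (wl : length_fun w) (r0 : 0 < r) (d0 : 0 < dens (ball w (r / 2))).

Lemma avg_bump_gt0 : 0 < avg (bump w r).
Proof.
by apply: lt_le_trans (avg_bump_ge w (ltW r0)); rewrite mulr_gt0 // divr_gt0.
Qed.

Lemma bump_weightP : weight (bump_weight w r).
Proof.
have a0 := avg_bump_gt0; split=> [x|]; last by rewrite avgZr divff // gt_eqF.
by rewrite mulr_ge0 ?le_max ?lexx // invr_ge0 ltW.
Qed.

Lemma bump_weightN x : bump_weight w r (- x) = bump_weight w r x.
Proof. by rewrite /bump_weight /bump; case: wl => _ -> _. Qed.

Lemma bump_weight_supp x : bump_weight w r x != 0 -> w x <= r.
Proof.
apply: contraR; rewrite -ltNge => wr; rewrite /bump_weight /bump.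
by rewrite max_l ?mul0r // subr_le0 ltW.
Qed.

Lemma bump_weight_shift d :
  avg (fun x => `|bump_weight w r (x + d) - bump_weight w r x|)
    <= w d / avg (bump w r).
Proof.
have a0 := avg_bump_gt0; apply: avg_le_cst => // x.
have ai0 : 0 <= (avg (bump w r))^-1 by rewrite invr_ge0 ltW.
rewrite -mulrBl normrM (ger0_norm ai0) ler_pM2r ?invr_gt0 // /bump.
case: wl => _ wN wD; have := wD x d; have := wD (x + d) (- d).
rewrite addrK wN => h1 h2.
rewrite ler_norml; case: (lerP 0 (r - w (x + d))) => ?;
  case: (lerP 0 (r - w x)) => ?; apply/andP; split; lra.
Qed.

End Bump.

(** The difference is a sum of two independent parts weighted by [nu]; the extra variable makes
    [bilinear_bound] applicable. *)
Definition T3 nu f1 f2 f3 : R :=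
  avg (fun x => avg (fun a => avg (fun b =>
    nu a * nu b * (f1 x * f2 (x + (a + b)) * f3 (x + (a + b) + (a + b)))))).

Lemma T3B1 nu f g f2 f3 :
  T3 nu (fun x => f x - g x) f2 f3 = T3 nu f f2 f3 - T3 nu g f2 f3.
Proof.
rewrite /T3 -avgB; apply: eq_avg => x; rewrite -avgB; apply: eq_avg => a.
by rewrite -avgB; apply: eq_avg => b; ring.
Qed.

Lemma T3B2 nu f g f1 f3 :
  T3 nu f1 (fun x => f x - g x) f3 = T3 nu f1 f f3 - T3 nu f1 g f3.
Proof.
rewrite /T3 -avgB; apply: eq_avg => x; rewrite -avgB; apply: eq_avg => a.
by rewrite -avgB; apply: eq_avg => b; ring.
Qed.

Lemma T3B3 nu f g f1 f2 :
  T3 nu f1 f2 (fun x => f x - g x) = T3 nu f1 f2 f - T3 nu f1 f2 g.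
Proof.
rewrite /T3 -avgB; apply: eq_avg => x; rewrite -avgB; apply: eq_avg => a.
by rewrite -avgB; apply: eq_avg => b; ring.
Qed.

Lemma avg3_shift (F : G -> G -> G -> R) (s : G -> G -> G) :
  avg (fun x => avg (fun a => avg (fun b => F x a b))) =
  avg (fun x => avg (fun a => avg (fun b => F (x + s a b) a b))).
Proof.
rewrite exchange_avg [RHS]exchange_avg; apply: eq_avg => a.
rewrite exchange_avg [RHS]exchange_avg; apply: eq_avg => b.
by rewrite (avg_shift (s a b) (fun x => F x a b)).
Qed.

(** Recentring [x] by [s] puts the argument of [g] at [x], after which averaging over [a] and [b]
    costs nothing. *)
Lemma norm_avg3_le nu g (F : G -> G -> G -> R) (s : G -> G -> G) :
  weight nu ->
  (forall x a b, `|F (x + s a b) a b| <= `|g x|) ->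
  `|avg (fun x => avg (fun a => avg (fun b => nu a * nu b * F x a b)))|
    <= avg (fun x => `|g x|).
Proof.
move=> wn Fg; rewrite (avg3_shift _ s).
apply: le_trans (norm_avg G0 _) _; apply: le_avg => // x.
apply: le_trans (norm_avg G0 _) _.
rewrite -[leRHS](wavg_cst _ wn); apply: le_avg => // a.
apply: le_trans (norm_avg G0 _) _.
rewrite -[`|g x|](wavg_cst _ wn) -avgZ; apply: le_avg => // b.
rewrite !normrM !(ger0_norm (wn.1 _)) -mulrA.
by apply: ler_wpM2l; [apply: wn.1 | apply: ler_wpM2l; [apply: wn.1 | apply: Fg]].
Qed.

Let mulr_norm_le1 (a b c : R) : `|a| <= 1 -> `|b| <= 1 -> `|a * b * c| <= `|c|.
Proof.
move=> a1 b1; rewrite !normrM -[leRHS]mul1r; apply: ler_wpM2r => //.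
by rewrite -[leRHS]mulr1; apply: ler_pM.
Qed.

Lemma T3_le1 nu g f2 f3 : weight nu ->
  (forall x, `|f2 x| <= 1) -> (forall x, `|f3 x| <= 1) ->
  `|T3 nu g f2 f3| <= avg (fun x => `|g x|).
Proof.
move=> wn h2 h3; apply: (norm_avg3_le (s := fun _ _ => 0)) => // x a b.
by rewrite addr0 -mulrA mulrC; apply: mulr_norm_le1.
Qed.

Lemma T3_le2 nu f1 g f3 : weight nu ->
  (forall x, `|f1 x| <= 1) -> (forall x, `|f3 x| <= 1) ->
  `|T3 nu f1 g f3| <= avg (fun x => `|g x|).
Proof.
move=> wn h2 h3; apply: (norm_avg3_le (s := fun a b => - (a + b))) => // x a b.
by rewrite subrK mulrAC; apply: mulr_norm_le1.
Qed.

Lemma T3_le3 nu f1 f2 g : weight nu ->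
  (forall x, `|f1 x| <= 1) -> (forall x, `|f2 x| <= 1) ->
  `|T3 nu f1 f2 g| <= avg (fun x => `|g x|).
Proof.
move=> wn h2 h3.
apply: (norm_avg3_le (s := fun a b => - (a + b) - (a + b))) => // x a b.
by rewrite (addrA x (- _)) !subrK; apply: mulr_norm_le1.
Qed.

Section Uniform.
Variables (nu g : G -> R) (K th : R).
Hypotheses (nu0 : forall x, 0 <= nu x) (nuK : forall x, nu x <= K) (th0 : 0 <= th).
Hypothesis dbl : injective (fun x : G => x + x).
Hypothesis gth : K ^+ 4 * avg (fun d => `|autocorr g d|) <= th ^+ 2.

Let nu1 (f : G -> R) (t : G -> G) a : (forall x, `|f x| <= 1) -> `|nu a * f (t a)| <= K.
Proof.
move=> f1; rewrite normrM (ger0_norm (nu0 a)) -[leRHS]mulr1.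
exact: ler_pM.
Qed.

Let uniform_avg (p q : G -> G -> R) (ph : G -> G -> G) (ps : G -> G) :
  (forall x, injective (ph x)) -> injective ps ->
  (forall x a, `|p x a| <= K) -> (forall x b, `|q x b| <= K) ->
  `|avg (fun x => avg (fun a => avg (fun b => p x a * q x b * g (ph x a + ps b))))| <= th.
Proof.
move=> phI psI pK qK; apply: le_trans (norm_avg G0 _) _; apply: avg_le_cst => // x.
rewrite -(@ler_pXn2r _ 2) ?nnegrE // real_normK ?num_real //.
by apply: le_trans gth; apply: bilinear_bound.
Qed.

Let dbl_inj x : injective (fun a => x + a + a).
Proof. by move=> a b; rewrite -!addrA => /addrI /dbl. Qed.

(** Replacing [x] by [x - (2a + b)] turns the points into [x - 2a - b], [x - a], [x + b]: the two
    bounded factors depend on one variable each, as [bilinear_bound] requires. *)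
Lemma T3_uniform1 f2 f3 : (forall x, `|f2 x| <= 1) -> (forall x, `|f3 x| <= 1) ->
  `|T3 nu g f2 f3| <= th.
Proof.
move=> h2 h3; rewrite /T3 (avg3_shift _ (fun a b => - (a + a + b))).
rewrite (eq_avg (g := fun x => avg (fun a => avg (fun b =>
   (nu a * f2 (x - a)) * (nu b * f3 (x + b)) * g (x - a - a + - b))))).
  apply: uniform_avg => [x a b|a b|x a|x b]; last 2 first.
  - exact: (@nu1 f2 (fun a => x - a) a h2).
  - exact: (@nu1 f3 (fun b => x + b) b h3).
  - by rewrite -!addrA => /addrI; rewrite -!opprD => /oppr_inj /dbl.
  - exact: oppr_inj.
move=> x; apply: eq_avg => a; apply: eq_avg => b.
have -> : x - (a + a + b) = x - a - a - b by rewrite !opprD !addrA.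
have -> : x - a - a - b + (a + b) = x - a.
  by rewrite [a + b]addrC addrA subrK subrK.
by rewrite addrA subrK; ring.
Qed.

(** Here [x - 2b] gives the points [x - 2b], [x + a - b], [x + 2a]. *)
Lemma T3_uniform2 f1 f3 : (forall x, `|f1 x| <= 1) -> (forall x, `|f3 x| <= 1) ->
  `|T3 nu f1 g f3| <= th.
Proof.
move=> h2 h3; rewrite /T3 (avg3_shift _ (fun a b => - (b + b))).
rewrite (eq_avg (g := fun x => avg (fun a => avg (fun b =>
   (nu a * f3 (x + a + a)) * (nu b * f1 (x - b - b)) * g (x + a + - b))))).
  apply: uniform_avg => [x|a b|x a|x b]; last 2 first.
  - exact: (@nu1 f3 (fun a => x + a + a) a h3).
  - exact: (@nu1 f1 (fun b => x - b - b) b h2).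
  - exact: addrI.
  - exact: oppr_inj.
move=> x; apply: eq_avg => a; apply: eq_avg => b.
have -> : x - (b + b) = x - b - b by rewrite opprD addrA.
have -> : x - b - b + (a + b) = x + a - b.
  by rewrite [a + b]addrC addrA subrK addrAC.
have -> : x + a - b + (a + b) = x + a + a.
  by rewrite [a + b]addrC addrA subrK.
by ring.
Qed.

(** Here [x - b] gives the points [x - b], [x + a], [x + 2a + b]. *)
Lemma T3_uniform3 f1 f2 : (forall x, `|f1 x| <= 1) -> (forall x, `|f2 x| <= 1) ->
  `|T3 nu f1 f2 g| <= th.
Proof.
move=> h2 h3; rewrite /T3 (avg3_shift _ (fun a b => - b)).
rewrite (eq_avg (g := fun x => avg (fun a => avg (fun b =>
   (nu a * f2 (x + a)) * (nu b * f1 (x - b)) * g (x + a + a + b))))).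
  apply: uniform_avg => [x|a b //|x a|x b]; last 2 first.
  - exact: (@nu1 f2 (fun a => x + a) a h3).
  - exact: (@nu1 f1 (fun b => x - b) b h2).
  - exact: dbl_inj.
move=> x; apply: eq_avg => a; apply: eq_avg => b.
have -> : x - b + (a + b) = x + a by rewrite [a + b]addrC addrA subrK.
by rewrite addrA; ring.
Qed.

End Uniform.

End Length.
Arguments dens R {G}.

(** * Energy and the autocorrelation of the remainder *)

Section Counting.
Variables (R : realFieldType) (G : finZmodType).
Hypothesis dbl : injective (fun x : G => x + x).
Let G0 := card_zmod_gt0 G.

Definition unit_valued (f : G -> R) := forall x, 0 <= f x <= 1.

(** Small [w d] makes [d] an L1 almost period of the autocorrelation of [f]. *)
Definition controls (w f : G -> R) :=
  length_fun w /\
  forall d, avg (fun x => `|autocorr f (x + d) - autocorr f x|) <= w d.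

(* Convolving twice makes the operator positive: this is what bounds the L2 norm of the middle
   term in [middle] by the increment of [energy]. *)
Definition conv2 (mu f : G -> R) : G -> R := conv mu (conv mu f).

Definition energy (w f : G -> R) (r : R) := avg (fun x => conv (bump_weight w r) f x ^+ 2).

Lemma conv_unit mu f : weight mu -> unit_valued f -> unit_valued (conv mu f).
Proof.
move=> wm f1 x; apply/andP; split.
  by apply: wavg_ge => // y _; case/andP: (f1 (x + y)).
by apply: wavg_le => // y _; case/andP: (f1 (x + y)).
Qed.

Lemma unit_norm f : unit_valued f -> forall x, `|f x| <= 1.
Proof. by move=> f1 x; have /andP[h0 h1] := f1 x; rewrite ger0_norm. Qed.

Lemma energy_le1 w f r : weight (bump_weight w r) -> unit_valued f -> energy w f r <= 1.
Proof.
move=> wm f1; apply: avg_le_cst => // x.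
by have /andP[h0 h1] := conv_unit wm f1 x; rewrite expr_le1.
Qed.

(** [P := conv2 mu] commutes with shifts and is self-adjoint, so each of the two factors [f - P f]
    contributes one [1 - P] acting on the autocorrelation. *)
Lemma autocorr_conv2 mu f d : (forall x, mu (- x) = mu x) ->
  autocorr (fun x => f x - conv2 mu f x) d =
  (autocorr f d - conv2 mu (autocorr f) d) -
  conv2 mu (fun e => autocorr f e - conv2 mu (autocorr f) e) d.
Proof.
move=> mN.
(* Averaging a correlation over its shift averages its second factor. *)
have cv (u g : G -> R) e :
    conv mu (fun h => avg (fun y => u y * g (y + h))) e =
    avg (fun y => u y * conv mu g (y + e)).
  rewrite /conv; under eq_avg do rewrite -avgZ.
  rewrite exchange_avg; apply: eq_avg => y; rewrite -avgZ; apply: eq_avg => z.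
  by rewrite addrA mulrCA.
have cv2 (u g : G -> R) e :
    conv2 mu (fun h => avg (fun y => u y * g (y + h))) e =
    avg (fun y => u y * conv2 mu g (y + e)).
  by rewrite /conv2 (eq_conv _ (cv u g)) cv.
pose u x := f x - conv2 mu f x.
(* The operator on the first factor crosses to the second by self-adjointness, once for each
   convolution. *)
have H e : autocorr f e - conv2 mu (autocorr f) e = avg (fun y => u y * f (y + e)).
  rewrite cv2 /autocorr.
  have -> : avg (fun y => u y * f (y + e)) =
     avg (fun y => f y * f (y + e)) - avg (fun y => conv2 mu f y * f (y + e)).
    by rewrite -avgB; apply: eq_avg => y; rewrite mulrBl.
  congr (_ - _); rewrite /conv2 (conv_selfadj _ _ mN) (conv_selfadj _ _ mN).
  apply: eq_avg => y; congr (_ * _); rewrite -conv_shift.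
  by apply: eq_conv => z; rewrite conv_shift.
rewrite H [conv2 mu _ d](_ : _ = avg (fun y => u y * conv2 mu f (y + d))); last first.
  rewrite -cv2 /conv2; apply: eq_conv; apply: eq_conv; exact: H.
by rewrite -avgB; apply: eq_avg => y; rewrite -mulrBr.
Qed.

Lemma avg_norm_sub_conv2 mu (g : G -> R) k : weight mu ->
  avg (fun x => `|g x - conv mu g x|) <= k ->
  avg (fun x => `|g x - conv2 mu g x|) <= k + k.
Proof.
move=> wm gk.
apply: (@le_trans _ _ (avg (fun x => `|g x - conv mu g x| +
    `|conv mu (fun y => g y - conv mu g y) x|))).
  apply: le_avg => // x; rewrite convB.
  by apply: le_trans (ler_normD _ _); rewrite addrA subrK.
by rewrite avgD lerD // (le_trans (avg_norm_conv _ wm)).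
Qed.

Lemma avg_norm_conv2 mu (g : G -> R) : weight mu ->
  avg (fun x => `|conv2 mu g x|) <= avg (fun x => `|g x|).
Proof. by move=> wm; apply: le_trans (avg_norm_conv _ wm) (avg_norm_conv _ wm). Qed.

(** One average moves the autocorrelation by at most [r] in L1, since [mu] lives on shifts of length
    at most [r]; [conv2] doubles this, and the second [1 - conv2 mu] of [autocorr_conv2] doubles it
    again. *)
Lemma autocorr_remainder w f r mu : controls w f -> weight mu ->
  (forall x, mu (- x) = mu x) -> (forall x, mu x != 0 -> w x <= r) ->
  avg (fun d => `|autocorr (fun x => f x - conv2 mu f x) d|) <= 4 * r.
Proof.
move=> [wl wf] wm mN msupp.
have near : avg (fun d => `|autocorr f d - conv mu (autocorr f) d|) <= r.
  apply: (@le_trans _ _ (avg (fun d => avg (fun y =>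
      mu y * `|autocorr f (d + y) - autocorr f d|)))).
    apply: le_avg => // d.
    rewrite -{1}[autocorr f d](wavg_cst _ wm) -avgB.
    apply: le_trans (norm_avg G0 _) _; apply: le_avg => // y.
    by rewrite -mulrBr normrM (ger0_norm (wm.1 y)) distrC.
  rewrite exchange_avg; apply: (@le_trans _ _ (avg (fun y => mu y * w y))).
    by apply: le_avg => // y; rewrite avgZ; apply: ler_wpM2l; [apply: wm.1|].
  exact: wavg_le.
have near2 := avg_norm_sub_conv2 wm near.
rewrite (eq_avg (g := fun d => `|(autocorr f d - conv2 mu (autocorr f) d) -
  conv2 mu (fun e => autocorr f e - conv2 mu (autocorr f) e) d|)); last first.
  by move=> d; rewrite autocorr_conv2.
apply: (@le_trans _ _ (avg (fun d => `|autocorr f d - conv2 mu (autocorr f) d| +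
  `|conv2 mu (fun e => autocorr f e - conv2 mu (autocorr f) e) d|))).
  by apply: le_avg => // d; rewrite -[leRHS]addr0; apply: le_trans (ler_normB _ _) _; rewrite addr0.
rewrite avgD; have := avg_norm_conv2 (fun e => autocorr f e - conv2 mu (autocorr f) e) wm.
lra.
Qed.

(** * One step of the energy increment, with averages [s] at radius [r] and [t] at radius [r'] *)

Section Increment.
Variables (w f : G -> R) (r rho r' ka la th c : R).
Hypotheses (f1 : unit_valued f) (wf : controls w f).
Hypotheses (r0 : 0 < r) (rho0 : 0 < rho) (r'0 : 0 < r') (r'rho : r' <= rho).
Hypotheses (la0 : 0 < la) (th0 : 0 <= th) (c0 : 0 < c).
Hypothesis dr : 0 < dens R (ball w (r / 2)).
Hypothesis dr' : 0 < dens R (ball w (r' / 2)).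
Hypothesis drho : c <= dens R (ball w rho).
Hypothesis rhoka : rho <= ka * avg (bump w r).
Hypothesis r'th : c^-1 ^+ 4 * (4 * r') <= th ^+ 2.
Hypothesis noinc : energy w f r' - energy w f r + 4 * ka <= la ^+ 2.

Let wl : length_fun w := wf.1.
Let mu := bump_weight w r.
Let mu' := bump_weight w r'.
Let s := conv2 mu f.
Let t := conv2 mu' f.
Let wm : weight mu := bump_weightP r0 dr.
Let wm' : weight mu' := bump_weightP r'0 dr'.
Let mN : forall x, mu (- x) = mu x := bump_weightN _ wl.
Let mN' : forall x, mu' (- x) = mu' x := bump_weightN _ wl.

(** The outer average in [s] inherits the Lipschitz bound of the tent, which [rhoka] turns into
    [ka]. *)
Let s_inv x d : w d <= rho -> `|s (x + d) - s x| <= ka.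
Proof.
move=> dw; have a0 : 0 < avg (bump w r) := avg_bump_gt0 r0 dr.
apply: le_trans (conv_inv _ _ _ (unit_norm (conv_unit wm f1))) _.
apply: le_trans (bump_weight_shift wl r0 dr d) _.
by rewrite ler_pdivrMr // (le_trans dw).
Qed.

Let conv2_s x : `|conv2 mu' s x - s x| <= 2 * ka.
Proof.
have h y : `|conv mu' s y - s y| <= ka.
  by apply: conv_near => // z /bump_weight_supp zr; apply/s_inv/(le_trans zr).
have h2 : `|conv mu' (conv mu' s) x - conv mu' s x| <= ka.
  rewrite -convB; apply: le_trans (norm_conv _ _ wm') _.
  exact: wavg_le.
have := ler_distD (conv mu' s x) (conv2 mu' s x) (s x).
by move=> /le_trans; apply; have := h x; rewrite /conv2; lra.
Qed.

(** Expand the square. The terms in [t ^+ 2] and [s ^+ 2] are at most the two energies. In the cross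
    term [conv2 mu'] moves onto [s], leaving [avg (f * s)], the energy at [r], up to [2 * ka]. *)
Let middle : avg (fun x => `|t x - s x|) <= la.
Proof.
apply: avg_norm_le => //; apply: le_trans noinc.
have cross : avg (fun x => t x * s x) >= energy w f r - 2 * ka.
  rewrite /t /conv2 (conv_selfadj _ _ mN') (conv_selfadj _ _ mN').
  have -> : energy w f r = avg (fun x => f x * s x).
    by rewrite /s /conv2 -(conv_selfadj _ _ mN); apply: eq_avg => x; rewrite expr2.
  rewrite -[X in _ - X](avg_cst G0) -avgB; apply: le_avg => // x.
  have /andP[fx0 fx1] := f1 x; have := conv2_s x; rewrite ler_norml /conv2 => /andP[h1 h2].
  have ka0 : 0 <= ka by lra.
  nra.
have E' : avg (fun x => t x ^+ 2) <= energy w f r' by apply: avg_sqr_conv.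
have E : avg (fun x => s x ^+ 2) <= energy w f r by apply: avg_sqr_conv.
have -> : avg (fun x => (t x - s x) ^+ 2) =
   avg (fun x => t x ^+ 2) + (avg (fun x => s x ^+ 2) - 2 * avg (fun x => t x * s x)).
  by rewrite -avgZ -avgB -avgD; apply: eq_avg => x; ring.
lra.
Qed.

Let nu := ball_weight w rho.
Let wn : weight nu := ball_weightP (lt_le_trans c0 drho).
Let s1 : unit_valued s := conv_unit wm (conv_unit wm f1).
Let t1 : unit_valued t := conv_unit wm' (conv_unit wm' f1).

(** On the support of the weights [s] is almost constant along progressions, so the count is nearly
    the average of [s ^+ 3]; convexity of the cube concludes. *)
Let structured : avg f ^+ 3 - 6 * ka <= T3 nu s s s.
Proof.
set al := avg f; have al0 : 0 <= al by apply: avg_ge0 => // x; case/andP: (f1 x).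
have as_ : avg s = al by rewrite /s /conv2 !avg_conv.
have ka0 : 0 <= ka.
  have a0 : 0 < avg (bump w r) := avg_bump_gt0 r0 dr.
  by rewrite -(ler_pM2r a0) mul0r; apply: le_trans rhoka; apply: ltW.
(* Tangent line of the cube at [al], evaluated at [s x] and averaged using [avg s = al]. *)
have -> : al ^+ 3 - 6 * ka = avg (fun x => (3 * al ^+ 2) * s x + (- 2 * al ^+ 3 - 6 * ka)).
  by rewrite avgD avg_cst // avgZ as_; ring.
apply: le_avg => // x; set C := (X in X <= _); rewrite -[C](wavg_cst _ wn).
apply: le_avg => // a; rewrite -[C](wavg_cst _ wn) -avgZ; apply: le_avg => // b.
rewrite -[leRHS]mulrA {}/C.
have [->|/ball_weight_supp wa] := eqVneq (nu a) 0; first by rewrite !mul0r.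
apply: ler_wpM2l; first exact: wn.1.
have [->|/ball_weight_supp wb] := eqVneq (nu b) 0; first by rewrite !mul0r.
apply: ler_wpM2l; first exact: wn.1.
have near y : `|s (y + (a + b)) - s y| <= 2 * ka.
  have h1 := s_inv y wa; have h2 := s_inv (y + a) wb.
  have := ler_distD (s (y + a)) (s (y + (a + b))) (s y).
  by rewrite addrA => /le_trans; apply; lra.
have := near x; have := near (x + (a + b)); rewrite !ler_norml.
move: (s1 x) (s1 (x + (a + b))) (s1 (x + (a + b) + (a + b))).
move: (s x) (s (x + (a + b))) (s (x + (a + b) + (a + b))) => p q u /andP[p0 p1] /andP[q0 q1] /andP[u0 u1].
move=> /andP[h1 h2] /andP[h3 h4].
have pqu : p ^+ 3 - 6 * ka <= p * q * u.
  (* From [q >= p - 2 * ka] and [u >= p - 4 * ka] the product loses at most [2 * ka + 4 * ka]. *)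
  have e1 : p * (p - 2 * ka) <= p * q by apply: ler_wpM2l => //; lra.
  have e2 : p * q * (p - 4 * ka) <= p * q * u.
    by apply: ler_wpM2l; [apply: mulr_ge0 | lra].
  have e3 : p * q * ka <= ka by rewrite -[leRHS]mul1r ler_wpM2r // mulr_ile1.
  have e4 : p * (p * (p - 2 * ka)) <= p * (p * q) by apply: ler_wpM2l.
  have e5 : p * p * ka <= ka by rewrite -[leRHS]mul1r ler_wpM2r // mulr_ile1.
  lra.
have : 0 <= (p - al) ^+ 2 * (p + 2 * al) by rewrite mulr_ge0 ?sqr_ge0 //; lra.
lra.
Qed.

(* [f] is split as [(f - t) + (t - s) + s]. *)
Lemma increment_count : avg f ^+ 3 - 6 * ka - 3 * la - 3 * th <= T3 nu f f f.
Proof.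
have g1 x : 0 <= nu x by apply: wn.1.
have g2 x : nu x <= c^-1 by apply: ball_weight_le.
have rem : c^-1 ^+ 4 * avg (fun d => `|autocorr (fun x => f x - t x) d|) <= th ^+ 2.
  apply: le_trans r'th; apply: ler_wpM2l; first by rewrite exprn_ge0 // invr_ge0 ltW.
  by apply: autocorr_remainder wf wm' mN' _ => x; apply: bump_weight_supp.
have nf := unit_norm f1; have nt := unit_norm t1; have ns := unit_norm s1.
(* Telescoping: [f] becomes [t] in slots 3, 2, 1 at cost [th] each, then [t] becomes [s] in the same
   order at cost [la] each. *)
have := T3_uniform3 g1 g2 th0 dbl rem nf nf.
have := T3_uniform2 g1 g2 th0 rem nf nt.
have := T3_uniform1 g1 g2 th0 dbl rem nt nt.
have := le_trans (T3_le3 (fun x => t x - s x) wn nt nt) middle.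
have := le_trans (T3_le2 (fun x => t x - s x) wn nt ns) middle.
have := le_trans (T3_le1 (fun x => t x - s x) wn ns ns) middle.
have := structured.
rewrite !(T3B1, T3B2, T3B3) !ler_norml.
move=> h /andP[h1 _] /andP[h2 _] /andP[h3 _] /andP[h4 _] /andP[h5 _] /andP[h6 _].
lra.
Qed.

End Increment.
End Counting.

(** * Iterating the increment; popular differences outside a sparse set *)

Section Popular.
Variable R : archiRealFieldType.

Definition ap3_density (G : finZmodType) (f : G -> R) (d : G) : R :=
  avg (fun x => f x * f (x + d) * f (x + d + d)).

Lemma T3_ap3_density (G : finZmodType) (nu f : G -> R) :
  T3 nu f f f = avg (fun a => nu a * avg (fun b => nu b * ap3_density f (a + b))).
Proof.
rewrite /T3 exchange_avg; apply: eq_avg => a; rewrite exchange_avg -avgZ.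
by apply: eq_avg => b; rewrite avgZ -mulrA.
Qed.

(** [n] counts the increments still possible below the energy bound 1. Radii and [c] are chosen
    before the group, hence uniformly in [G], [w] and [f]. *)
Lemma energy_induction (eps : R) (c0 : R -> R) (n : nat) (r : R) :
  0 < eps -> eps <= 1 -> (forall s, 0 < s -> 0 < c0 s) -> 0 < r ->
  exists2 c : R, 0 < c & forall (G : finZmodType) (w f : G -> R),
    injective (fun x : G => x + x) -> unit_valued f -> controls w f ->
    (forall s, 0 < s -> c0 s <= dens R (ball w s)) ->
    1 - n%:R * (eps ^+ 2 / 288) <= energy w f r ->
    exists rho, [/\ 0 < rho, rho <= r, c <= dens R (ball w rho)
      & avg f ^+ 3 - eps <= T3 (ball_weight w rho) f f f].
Proof.
move=> e0 e1 c0P.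
(* With [th = la] the loss [6 * ka + 6 * la] is below [eps], and [la ^+ 2 - 4 * ka = eps ^+ 2 / 288]
   is left for the increment. *)
pose la := eps / 12; pose ka := la ^+ 2 / 8.
have la0 : 0 < la by rewrite divr_gt0.
have la1 : la <= 1 by rewrite /la; lra.
have la2 : la ^+ 2 <= la by rewrite expr2 -[leRHS]mulr1 ler_pM2l.
have ka0 : 0 < ka by rewrite divr_gt0 // exprn_gt0.
have step s : 0 < s -> exists rho s' c1,
    [/\ 0 < rho, rho <= s, 0 < s', s' <= rho & 0 < c1] /\
    forall (G : finZmodType) (w f : G -> R),
    injective (fun x : G => x + x) -> unit_valued f -> controls w f ->
    (forall s, 0 < s -> c0 s <= dens R (ball w s)) ->
    [/\ c1 <= dens R (ball w rho), energy w f s' <= 1 &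
      energy w f s' - energy w f s <= eps ^+ 2 / 288 ->
      avg f ^+ 3 - eps <= T3 (ball_weight w rho) f f f].
  move=> s0; have s20 : 0 < s / 2 by rewrite divr_gt0.
  (* [s / 2 * c0 (s / 2)] bounds the average of the tent from below. *)
  pose rho := Num.min s (ka * (s / 2 * c0 (s / 2))).
  have rho0 : 0 < rho by rewrite lt_min s0 /= mulr_gt0 // mulr_gt0 // c0P.
  pose c1 := c0 rho; have c10 : 0 < c1 by apply: c0P.
  (* Makes [c1^-1 ^+ 4 * (4 * s')] at most [la ^+ 2]. *)
  pose s' := Num.min rho (la ^+ 2 * c1 ^+ 4 / 4).
  have s'0 : 0 < s' by rewrite lt_min rho0 /= divr_gt0 // mulr_gt0 // exprn_gt0.
  exists rho, s', c1; split; first by split=> //; rewrite ge_min lexx.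
  move=> G w f dbl f1 wf wd.
  have dp u : 0 < u -> 0 < dens R (ball w u).
    by move=> u0; apply: lt_le_trans (wd u u0); apply: c0P.
  have s'20 : 0 < s' / 2 by rewrite divr_gt0.
  split; first exact: wd.
    by apply: energy_le1 => //; apply: bump_weightP; last apply: dp.
  move=> en; apply: le_trans (@increment_count R G dbl w f s rho s' ka la la c1
     f1 wf s0 rho0 s'0 _ la0 (ltW la0) c10 (dp _ s20) (dp _ s'20) (wd _ rho0) _ _ _).
  - by rewrite /ka; rewrite /la in la2 *; lra.
  - by rewrite ge_min lexx.
  - apply: (@le_trans _ _ (ka * (s / 2 * c0 (s / 2)))); first by rewrite ge_min lexx orbT.
    rewrite ler_pM2l //; apply: le_trans (avg_bump_ge w (ltW s0)).
    by rewrite ler_pM2l // wd.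
  - have : s' <= la ^+ 2 * c1 ^+ 4 / 4 by rewrite ge_min lexx orbT.
    move=> h; rewrite exprVn mulrC ler_pdivrMr ?exprn_gt0 //; lra.
  - by rewrite /ka /la in en *; lra.
elim: n r => [|n IH] r r0; have [rho [r' [c1 [[rho0 rhor r'0 r'rho c10] Hstep]]]] := step r r0.
  exists c1 => // G w f dbl f1 wf wd en.
  have [h1 h2 h3] := Hstep G w f dbl f1 wf wd; exists rho; split=> //.
  by apply: h3; have := sqr_ge0 eps; lra.
have [c2 c20 H2] := IH r' r'0.
exists (Num.min c1 c2); first by rewrite lt_min c10.
move=> G w f dbl f1 wf wd en; have [h1 h2 h3] := Hstep G w f dbl f1 wf wd.
(* Either the current radii serve, or the energy at [r'] has gained a full increment and the
   induction hypothesis applies there. *)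
have [small|big] := lerP (energy w f r' - energy w f r) (eps ^+ 2 / 288).
  by exists rho; split=> //; rewrite ?ge_min ?h1 //; apply: h3.
have [|rho' [g1 g2 g3 g4]] := H2 G w f dbl f1 wf wd.
  by rewrite -natr1 in en; lra.
exists rho'; split=> //; last by rewrite ge_min g3 orbT.
by apply: le_trans g2 _; apply: le_trans r'rho rhor.
Qed.

(** If no good difference existed, the weighted count would be too small: the weight is at most
    [c^-1], so [B] carries little of it. *)
Lemma popular_difference_weighted (eps : R) (c0 : R -> R) :
  0 < eps -> eps <= 1 -> (forall s, 0 < s -> 0 < c0 s) ->
  exists2 c : R, 0 < c & forall (G : finZmodType) (w f : G -> R),
    injective (fun x : G => x + x) -> unit_valued f -> controls w f ->
    (forall s, 0 < s -> c0 s <= dens R (ball w s)) ->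
    forall B : {set G}, dens R B <= c ->
    exists d, [/\ d \notin B, w d <= eps & avg f ^+ 3 - eps <= ap3_density f d].
Proof.
(* Radii up to [e] keep [a + b] within length [eps], and the other half of [eps] absorbs the
   contribution of [B]. *)
move=> e0 e1 c0P; pose e := eps / 2.
have e'0 : 0 < e by rewrite divr_gt0.
have e'1 : e <= 1 by rewrite /e; lra.
pose n := Num.bound (eps ^+ 2 / 288 / 4)^-1.
have [c c_gt0 H] := energy_induction n e'0 e'1 c0P e'0.
exists (c * (e / 4)); first by rewrite mulr_gt0 // divr_gt0.
move=> G w f dbl f1 wf wd B dB.
have G0 := card_zmod_gt0 G.
have en : 1 - n%:R * (e ^+ 2 / 288) <= energy w f e.
  apply: (@le_trans _ _ 0); last by apply: avg_ge0 => // x; apply: sqr_ge0.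
  have q0 : 0 < eps ^+ 2 / 288 / 4 by rewrite !divr_gt0 // exprn_gt0.
  have := archi_boundP (ltW (_ : 0 < (eps ^+ 2 / 288 / 4)^-1)).
  rewrite invr_gt0 => /(_ q0); rewrite -/n -(ltr_pM2r q0) mulVf ?gt_eqF //.
  by rewrite /e; lra.
have [rho [rho0 rhoe crho lower]] := H G w f dbl f1 wf wd en.
have wn : weight (ball_weight w rho) := ball_weightP (lt_le_trans c_gt0 crho).
pose v := avg f ^+ 3 - eps.
have [d /and3P[h1 h2 h3]|none] :=
  pickP (fun d => [&& d \notin B, w d <= eps & v <= ap3_density f d]).
  by exists d.
exfalso; move: lower; rewrite T3_ap3_density; apply/negP; rewrite -ltNge.
have t1 d : ap3_density f d <= 1.
  apply: avg_le_cst => // x.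
  by have := f1 x; have := f1 (x + d); have := f1 (x + d + d);
     move=> /andP[? ?] /andP[? ?] /andP[? ?]; rewrite !mulr_ile1 // mulr_ge0.
(* Differences in [B] have density at most 1, hence exceed [v] by at most 3. *)
have v1 : 1 <= v + 3.
  have : 0 <= avg f ^+ 3.
    by apply: exprn_ge0; apply: avg_ge0 => // x; case/andP: (f1 x).
  by rewrite /v; lra.
apply: (@le_lt_trans _ _ (v + 3 * (e / 4))); last by rewrite /v /e; lra.
apply: wavg_le => // a /ball_weight_supp wa.
apply: (@le_trans _ _ (avg (fun b => ball_weight w rho b * v +
    3 * (ball_weight w rho b * (a + b \in B)%:R)))).
  apply: le_avg => // b; rewrite [3 * _]mulrCA -mulrDr.
  have [->|/ball_weight_supp wb] := eqVneq (ball_weight w rho b) 0.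
    by rewrite !mul0r.
  apply: ler_wpM2l; first exact: wn.1.
  have := none (a + b); case: (a + b \in B) => /=.
    by move=> _; have := t1 (a + b); lra.
  have -> /= : w (a + b) <= eps.
    have [_ _ wD] := wf.1; apply: le_trans (wD a b) _.
    by rewrite /e in rhoe; lra.
  by move=> /negbT; rewrite -ltNge; lra.
rewrite avgD wavg_cst // lerD2l avgZ ler_pM2l //.
apply: (@le_trans _ _ (avg (fun b => c^-1 * (b + a \in B)%:R))).
  by apply: le_avg => // b; rewrite addrC ler_wpM2r // ball_weight_le.
rewrite avgZ (avg_shift a (fun b => (b \in B)%:R)) -dens_avg mulrC.
by rewrite ler_pdivrMr // mulrC.
Qed.

End Popular.

(** * Random sampling: balls of the shift length are dense *)

Lemma exists_le_avg (R : realFieldType) (T : finType) (g : T -> R) :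
  (0 < #|T|)%N -> exists y, g y <= avg g.
Proof.
move=> T0; have [y hy|none] := pickP (fun y => g y <= avg g); first by exists y.
have [y0 _] := card_gt0P T0.
have : \sum_y (g y - avg g) = 0.
  by rewrite big_split /= sumrN sumr_const -mulr_natr mulfVK ?subrr // pnatr_eq0 -lt0n.
move/eqP; rewrite psumr_eq0; last first.
  by move=> y _; rewrite subr_ge0 ltW // ltNge none.
move/allP => /(_ y0 (mem_index_enum _)) /=; rewrite subr_eq0 => /eqP e.
by have := none y0; rewrite e lexx.
Qed.

Lemma pigeonhole_fiber (T C : finType) (S : {set T}) (code : T -> C) : S != set0 ->
  exists2 s, s \in S & (#|S| <= #|C| * #|[set d in S | code d == code s]|)%N.
Proof.
case/set0Pn => s0 s0S; pose m d := #|[set d' in S | code d' == code d]|.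
have [s sS smax] := arg_maxnP m s0S.
exists s => //; rewrite -/(m s) -sum1_card (partition_big code predT) //= -sum_nat_const.
apply: leq_sum => c _; have [d /andP[dS /eqP dc]|none] := pickP (fun d => (d \in S) && (code d == c)).
  apply: leq_trans (smax d dS); rewrite /m -sum1_card; apply/eq_leq/eq_bigl => e.
  by rewrite inE dc.
by rewrite big_pred0.
Qed.

Section Sampling.
Variables (R : archiRealFieldType) (G : finZmodType) (A : {set G}).
Let G0 := card_zmod_gt0 G.

Definition indic (x : G) : R := (x \in A)%:R.

Lemma indic_unit : unit_valued indic.
Proof. by move=> x; rewrite /indic; case: (x \in A); rewrite ?lexx ?ler01. Qed.

Let F := autocorr indic.
(** Centred sample at [y] of [F (x + d)]. It is arranged so that, apart from the mean, [d] enters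
    only through whether [y - d] is in [A]: [k] samples leave [2 ^ k] patterns. *)
Let X d x y := indic (y - d) * indic (y + x) - F (x + d).

Let FE d x : F (x + d) = avg (fun y => indic (y - d) * indic (y + x)).
Proof.
rewrite -[RHS](avg_shift d); apply: eq_avg => y.
by rewrite addrK [x + d]addrC addrA.
Qed.

Let F01 : unit_valued F.
Proof.
move=> x; have I := indic_unit; apply/andP; split.
  apply: avg_ge0 => // y; have /andP[? ?] := I y; have /andP[? ?] := I (y + x).
  exact: mulr_ge0.
apply: avg_le_cst => // y; have /andP[? ?] := I y; have /andP[? ?] := I (y + x).
exact: mulr_ile1.
Qed.

Let X0 d x : avg (X d x) = 0.
Proof. by rewrite avgB avg_cst // FE subrr. Qed.

Let X1 d x y : X d x y ^+ 2 <= 1.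
Proof.
rewrite -real_normK ?num_real // expr_le1 //.
rewrite /X /indic -natrM mulnb; have /andP[? ?] := F01 (x + d).
case: (_ && _) => /=; rewrite ler_norml; apply/andP; split; lra.
Qed.

(* The sample is drawn one point at a time: since [X d x] has mean zero, some next point
   increases the mean square of the partial sums by at most one. *)
Lemma greedy_sample k : exists2 Y : seq G, size Y = k &
  avg (fun d => avg (fun x => (\sum_(y <- Y) X d x y) ^+ 2)) <= k%:R.
Proof.
elim: k => [|k [Y sY hY]].
  exists [::] => //; apply: avg_le_cst => // d; apply: avg_le_cst => // x.
  by rewrite big_nil expr0n.
pose S d x := \sum_(y <- Y) X d x y.
have [y hy] := exists_le_avg
  (fun y => avg (fun d => avg (fun x => (X d x y + S d x) ^+ 2))) G0.
exists (y :: Y); first by rewrite /= sY.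
under eq_avg do under eq_avg do rewrite big_cons.
apply: le_trans hy _.
rewrite exchange_avg -natr1; apply: (@le_trans _ _
  (avg (fun d => avg (fun x => S d x ^+ 2) + 1))); last by rewrite avgD avg_cst // lerD2r.
apply: le_avg => // d; rewrite exchange_avg -[X in _ + X](avg_cst G0) -avgD.
apply: le_avg => // x.
rewrite (eq_avg (g := fun y => X d x y ^+ 2 + (X d x y * (2 * S d x) + S d x ^+ 2))).
  rewrite avgD avgD avgZr X0 mul0r add0r avg_cst // addrC lerD2l.
  exact: avg_le_cst.
by move=> z; ring.
Qed.

Variable l : G -> R.
Hypothesis ll : length_fun l.

(** Total boundedness at a linear rate, as for a circle cut into [M.+1] equal arcs. *)
Definition coverable := forall M : nat, exists col : G -> 'I_M.+1,
  forall d e, col d = col e -> l (d - e) <= M.+1%:R^-1.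

Hypothesis lc : coverable.

Definition shift_length d := avg (fun x => `|F (x + d) - F x|) + l d.

Lemma shift_length_controls : controls shift_length indic.
Proof.
case: ll => l0 lN lD; split; last by move=> d; rewrite lerDl.
split=> [x|x|x y]; first by rewrite addr_ge0 // avg_ge0.
  rewrite /shift_length lN -(avg_shift x); congr (_ + _); apply: eq_avg => y.
  by rewrite addrK distrC.
rewrite /shift_length [leRHS]addrACA; apply: lerD => //.
rewrite -(avg_shift y (fun z => `|F (z + x) - F z|)) -avgD; apply: le_avg => // z.
have -> : z + (x + y) = z + y + x by rewrite addrC addrAC -addrA addrC.
exact: ler_distD.
Qed.

(** One half from Markov's inequality, divided by the number of codes: sample patterns times
    colours. *)
Definition ball_bound (r : R) : R :=
  (2 * (2 ^ Num.bound (8 / (r / 2) ^+ 2) * (Num.bound (r / 2)^-1).+1)%:R)^-1.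

Lemma ball_bound_gt0 r : 0 < ball_bound r.
Proof. by rewrite invr_gt0 mulr_gt0 // ltr0n muln_gt0 expn_gt0. Qed.

(** Most shifts are well sampled, and two well-sampled shifts with the same code differ by an
    element of the ball; the largest code class, translated, lies in it. *)
Lemma ball_bound_le r : 0 < r -> ball_bound r <= dens R (ball shift_length r).
Proof.
move=> r0; rewrite /ball_bound; set la := r / 2.
have la0 : 0 < la by rewrite divr_gt0.
set k := Num.bound _; set M := Num.bound _.
have kla : 8 / la ^+ 2 < k%:R by apply: archi_boundP; rewrite divr_ge0 // sqr_ge0.
have k0 : 0 < k%:R :> R by apply: le_lt_trans kla; rewrite divr_ge0 // sqr_ge0.
have Mla : la^-1 < M%:R by apply: archi_boundP; rewrite invr_ge0 ltW.
have [Y sY hY] := greedy_sample k.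
have [col hcol] := lc M.
pose V d := avg (fun x => (\sum_(y <- Y) X d x y) ^+ 2).
pose S := [set d | V d <= 2 * k%:R].
(* Markov: the average of [V] is at most [k]. *)
have dS : 2^-1 <= dens R S.
  have : avg (fun d => (2 * k%:R) * (1 - (d \in S)%:R)) <= avg V.
    apply: le_avg => // d; rewrite inE; case: (boolP (V d <= _)) => h.
      by rewrite subrr mulr0 avg_ge0 // => x; apply: sqr_ge0.
    by rewrite subr0 mulr1 ltW // ltNge.
  rewrite avgZ avgB avg_cst // -dens_avg => h; have {}h := le_trans h hY.
  have : k%:R * (2 * (1 - dens R S)) <= k%:R * 1 by lra.
  by rewrite ler_pM2l //; lra.
have N0 : 0 < #|G|%:R :> R by rewrite ltr0n.
have Sn : S != set0.
  by apply: contraTneq dS => ->; rewrite /dens cards0 mul0r -ltNge invr_gt0.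
pose code d := (map_tuple (fun y => y - d \in A) (in_tuple Y), col d).
have [s sS hs] := pigeonhole_fiber code Sn.
have cC : #|{: (size Y).-tuple bool * 'I_M.+1}| = (2 ^ k * M.+1)%N.
  by rewrite card_prod card_tuple card_bool card_ord sY.
rewrite cC in hs.
set U := [set d in S | _] in hs.
have UB : (#|U| <= #|ball shift_length r|)%N.
  rewrite -(card_imset (mem U) (addIr (- s))); apply: subset_leq_card; apply/subsetP => z /imsetP[d dU ->{z}].
  move: dU; rewrite !inE xpair_eqE => /andP[Vd /andP[/eqP e /eqP ce]].
  have Vs : V s <= 2 * k%:R by move: sS; rewrite inE.
  rewrite /shift_length; have -> : r = la + la by rewrite /la; lra.
  apply: lerD; last first.
    apply: le_trans (hcol _ _ ce) _; rewrite invf_ple ?posrE ?ltr0n //.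
    by rewrite ltW // (lt_trans Mla) // ltr_nat.
  rewrite -(avg_shift s).
  rewrite (eq_avg (g := fun x => `|F (x + d) - F (x + s)|)); last first.
    by move=> x; rewrite -addrA [s + _]addrC subrK.
  apply: avg_norm_le => //.
  (* Equal codes make the sampled products agree, so only the mean terms survive. *)
  have key x : k%:R * (F (x + d) - F (x + s)) =
      \sum_(y <- Y) X s x y - \sum_(y <- Y) X d x y.
    rewrite -sumrB; transitivity (\sum_(y <- Y) (F (x + d) - F (x + s))).
      by rewrite big_const_seq count_predT iter_addr_0 sY mulr_natl.
    apply: eq_big_seq => y yY; rewrite /X /indic.
    have -> : (y - d \in A) = (y - s \in A).
      have e' : [seq z - d \in A | z <- Y] = [seq z - s \in A | z <- Y].
        exact: (congr1 val e).
      have iY : (index y Y < size Y)%N by rewrite index_mem.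
      have := congr1 (fun t => nth false t (index y Y)) e'.
      by rewrite !(nth_map 0) // !nth_index.
    by ring.
  have : k%:R ^+ 2 * avg (fun x => (F (x + d) - F (x + s)) ^+ 2) <= 2 * V d + 2 * V s.
    rewrite -avgZ /V -!avgZ -avgD; apply: le_avg => // x.
    rewrite -exprMn key; set a := \sum_(y <- Y) X s x y; set b := \sum_(y <- Y) X d x y.
    by have := sqr_ge0 (a + b); lra.
  move=> h; have {}h : k%:R * (k%:R * avg (fun x => (F (x + d) - F (x + s)) ^+ 2))
     <= k%:R * 8 by lra.
  rewrite ler_pM2l // in h.
  rewrite -(ler_pM2l k0); apply: le_trans h _.
  by rewrite mulrC -ler_pdivrMl ?exprn_gt0 // mulrC ltW.
rewrite /dens ler_pdivlMr // ler_pdivrMl; last first.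
  by rewrite mulr_gt0 // ltr0n muln_gt0 expn_gt0.
have hsR : #|S|%:R <= (2 ^ k * M.+1)%:R * #|ball shift_length r|%:R :> R.
  by rewrite -natrM ler_nat (leq_trans hs) // leq_mul2l UB orbT.
by move: dS; rewrite /dens ler_pdivlMr // => dS; lra.
Qed.

End Sampling.

(** * Popular differences for sets *)

Definition ap3_pred (V : zmodType) (A : pred V) (d : V) : pred V :=
  fun x => [&& A x, A (x + d) & A (x + d + d)].

Theorem popular_difference (R : archiRealFieldType) (eps : R) :
  0 < eps -> eps <= 1 ->
  exists2 c : R, 0 < c & forall (G : finZmodType) (A : {set G}) (l : G -> R),
    injective (fun x : G => x + x) -> length_fun l -> coverable l ->
    forall B : {set G}, dens R B <= c ->
    exists d, [/\ d \notin B, l d <= eps &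
      dens R A ^+ 3 - eps <= dens R [set x | ap3_pred (mem A) d x]].
Proof.
move=> e0 e1.
have [c c0 H] := popular_difference_weighted e0 e1 (fun s _ => @ball_bound_gt0 R s).
exists c => // G A l dbl ll lc B /(H G _ _ dbl (indic_unit R A)
  (shift_length_controls A ll) (fun s => @ball_bound_le R G A l lc s))[d [h1 h2 h3]].
exists d; split=> //.
  by apply: le_trans h2; rewrite lerDr; apply: avg_ge0 => [|x]; rewrite ?card_zmod_gt0 ?normr_ge0.
rewrite [X in _ <= X](_ : _ = ap3_density (indic R A) d) ?[dens R A]dens_avg //.
rewrite dens_avg; apply: eq_avg => x; rewrite inE /ap3_pred /indic -!natrM !mulnb.
by rewrite /= andbA.
Qed.

Lemma sub_cube_le (R : realFieldType) (a b z : R) : 0 <= a <= 1 -> 0 <= b <= 1 -> 0 <= z ->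
  a - b <= z -> a ^+ 3 - b ^+ 3 <= 3 * z.
Proof.
move=> /andP[a0 a1] /andP[b0 b1] z0 ab.
have -> : a ^+ 3 - b ^+ 3 = (a - b) * (a * a + a * b + b * b) by ring.
have q0 : 0 <= a * a + a * b + b * b by rewrite !addr_ge0 // mulr_ge0.
have q3 : a * a + a * b + b * b <= 3.
  by have := mulr_ile1 a0 a0 a1 a1; have := mulr_ile1 a0 b0 a1 b1;
     have := mulr_ile1 b0 b0 b1 b1; lra.
apply: (@le_trans _ _ (z * (a * a + a * b + b * b))); first by apply: ler_wpM2r.
by rewrite mulrC ler_wpM2r.
Qed.

(** * Induction on the dimension, common to groups and intervals of integers *)

Section BoxInduction.
Variables (R : realFieldType) (V : zmodType).
Variables (cnt : pred V -> nat) (ok : pred V -> Prop) (half : V -> V) (N K : nat) (eta : R).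
Hypotheses (N0 : (0 < N)%N) (eta0 : 0 <= eta) (halfK : forall x, half (x + x) = x).
Hypothesis cntN : forall A, (cnt A <= N)%N.
Hypothesis eq_cnt : forall A B, A =1 B -> cnt A = cnt B.
Hypothesis okS : forall A B : pred V, ok A -> (forall x, B x -> A x) -> ok B.
Hypothesis step : forall (A : pred V) (B : seq V), ok A -> (size B <= K)%N ->
  exists2 d, d \notin B &
    ((cnt A)%:R / N%:R) ^+ 3 - eta <= (cnt (ap3_pred A d))%:R / N%:R.

Definition fcons (T : Type) r (e : T) (d : 'I_r -> T) : 'I_r.+1 -> T :=
  fun i => if unlift ord0 i is Some j then d j else e.

Lemma fcons0 T r (e : T) (d : 'I_r -> T) : fcons e d ord0 = e.
Proof. by rewrite /fcons unlift_none. Qed.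

Lemma fconsS T r (e : T) (d : 'I_r -> T) j : fcons e d (lift ord0 j) = d j.
Proof. by rewrite /fcons liftK. Qed.

Definition idx_tail r (i : boxidx r.+1) : boxidx r := [ffun j => i (lift ord0 j)].

Lemma boxsum_fcons r (e : V) (d : 'I_r -> V) (i : boxidx r.+1) :
  boxsum (fcons e d) i = e *+ i ord0 + boxsum d (idx_tail i).
Proof.
rewrite /boxsum big_ord_recl fcons0; congr (_ + _).
by apply: eq_bigr => j _; rewrite fconsS ffunE.
Qed.

Lemma box_in_fcons r (e : V) (d : 'I_r -> V) (A : pred V) :
  box_in (fcons e d) A =1 ap3_pred (box_in d A) e.
Proof.
move=> x; apply/forallP/and3P => [H|[/forallP h0 /forallP h1 /forallP h2] i].
  have {}H (a : 'I_3) (i : boxidx r) : A (x + e *+ a + boxsum d i).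
    have := H [ffun j => fcons a i j]; rewrite boxsum_fcons addrA ffunE fcons0.
    rewrite (_ : idx_tail _ = i) //.
    by apply/ffunP => j; rewrite !ffunE fconsS.
  split; apply/forallP => i.
  - by have := H ord0 i; rewrite addr0.
  - exact: (H (inord 1) i) || by have := H (inord 1) i; rewrite inordK.
  - by have := H (inord 2) i; rewrite inordK // mulr2n addrA.
rewrite boxsum_fcons addrA; case: (i ord0) => -[|[|[|//]]] /= _.
- by rewrite addr0.
- exact: h1.
- by rewrite mulr2n addrA.
Qed.

(* Differences [e] for which two cells of [fcons e d] collide: [e] or [e + e] is a difference
   of two sums of the smaller box. *)
Definition forbidden r (d : 'I_r -> V) : seq V :=
  let D := [seq boxsum d p.1 - boxsum d p.2 | p <- enum {: boxidx r * boxidx r}] in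
  D ++ map half D.

Lemma size_forbidden r (d : 'I_r -> V) : size (forbidden d) = (2 * 9 ^ r)%N.
Proof.
have sz : size (enum {: boxidx r * boxidx r}) = (9 ^ r)%N.
  transitivity #|{: boxidx r * boxidx r}|; first by rewrite cardE.
  by rewrite card_prod card_ffun !card_ord -expnMn.
rewrite size_cat (size_map half) (size_map (fun p => boxsum d p.1 - boxsum d p.2)).
by rewrite sz addnn mul2n.
Qed.

(** In a collision the coefficients of [e] differ by 1 or 2, which is forbidden, or agree; then [e]
    cancels and [d] being proper decides. *)
Lemma proper_fcons r (e : V) (d : 'I_r -> V) :
  proper_box d -> e \notin forbidden d -> proper_box (fcons e d).
Proof.
move=> dp; rewrite mem_cat negb_or => /andP[nD nhD].
have diffD (i i' : boxidx r) : boxsum d i - boxsum d i' \in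
    [seq boxsum d p.1 - boxsum d p.2 | p <- enum {: boxidx r * boxidx r}].
  by apply/mapP; exists (i, i') => //; rewrite mem_enum.
have no i i' : boxsum (fcons e d) i = boxsum (fcons e d) i' -> (i' ord0 <= i ord0)%N.
  rewrite !boxsum_fcons leqNgt => eq; apply/negP => lt.
  have {}eq : e *+ (i' ord0 - i ord0) = boxsum d (idx_tail i) - boxsum d (idx_tail i').
    rewrite mulrnBr 1?ltnW //; apply/eqP; rewrite subr_eq addrAC eq_sym subr_eq.
    by rewrite addrC eq addrC.
  have : (i' ord0 - i ord0 < 3)%N by apply: leq_ltn_trans (leq_subr _ _) _.
  move: lt eq; rewrite -subn_gt0; case: (_ - _)%N => [|[|[|//]]] // _ eq _.
    by move: nD; rewrite -[e]mulr1n eq diffD.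
  by move/negP: nhD; apply; rewrite -[e]halfK -mulr2n eq map_f.
move=> i i' eq.
have e0 : i ord0 = i' ord0.
  by apply/val_inj/eqP; rewrite eqn_leq !no.
move: eq; rewrite !boxsum_fcons e0 => /addrI /dp tl; apply/ffunP => j.
have [k ->|->] := unliftP ord0 j; last by [].
by have /ffunP/(_ k) := tl; rewrite !ffunE.
Qed.

(** Cubing at most triples the error, and [3 * 4 ^+ m * eta + eta] fits in [4 ^+ m.+1 * eta]. *)
Lemma cube_step (a b : R) m : 0 <= a <= 1 -> 0 <= b <= 1 ->
  a ^+ (3 ^ m) - 4 ^+ m * eta <= b -> a ^+ (3 ^ m.+1) - 4 ^+ m.+1 * eta <= b ^+ 3 - eta.
Proof.
move=> /andP[a0 a1] /andP[b0 b1].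
rewrite expnSr exprM; set p := a ^+ _ => pb.
have p0 : 0 <= p by rewrite exprn_ge0.
have p1 : p <= 1 by rewrite exprn_ile1.
have m1 : eta <= 4 ^+ m * eta.
  by rewrite ler_peMl // exprn_ege1 // ler1n.
rewrite (exprS 4) -mulrA; set z := 4 ^+ m * eta in pb m1 *.
suff : p ^+ 3 - b ^+ 3 <= 3 * z by lra.
have z0 : 0 <= z by apply: le_trans m1.
by apply: sub_cube_le => //; [apply/andP | apply/andP | lra].
Qed.

Lemma box_induction r (A : pred V) : ok A -> (2 * 9 ^ r <= K)%N ->
  exists d : 'I_r -> V, proper_box d /\
    ((cnt A)%:R / N%:R) ^+ (3 ^ r) - 4 ^+ r * eta <= (cnt (box_in d A))%:R / N%:R.
Proof.
move=> okA; have N0R : 0 < N%:R :> R by rewrite ltr0n.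
have rat01 B : 0 <= ((cnt B)%:R / N%:R : R) <= 1.
  by rewrite divr_ge0 // ler_pdivrMr // mul1r ler_nat cntN.
elim: r => [|r IH] hK.
  exists (fun=> 0); split; first by move=> i i' _; apply/ffunP => -[].
  rewrite expn0 expr1 expr0 mul1r (@eq_cnt (box_in _ A) A); first by rewrite lerBlDr lerDl.
  move=> x; rewrite /box_in; apply/forallP/idP => [/(_ [ffun=> ord0])|Ax i];
    by rewrite /boxsum big_ord0 addr0.
have [|d [dp dA]] := IH.
  by apply: leq_trans hK; rewrite leq_mul2l leq_exp2l // leqnSn.
have okB : ok (box_in d A).
  apply: okS okA _ => x /forallP /(_ [ffun=> ord0]).
  by rewrite /boxsum big1 ?addr0 // => j _; rewrite ffunE mulr0n.
have [|e ne he] := step okB (B := forbidden d).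
  by rewrite size_forbidden; apply: leq_trans hK; rewrite leq_mul2l leq_exp2l // leqnSn.
exists (fcons e d); split; first exact: proper_fcons.
rewrite (eq_cnt (box_in_fcons e d A)); apply: le_trans he.
exact: cube_step.
Qed.

End BoxInduction.

(** * Groups of odd order *)

Lemma dbl_inj_odd (G : finZmodType) : odd #|G| -> injective (fun x : G => x + x).
Proof.
move=> oG x y /eqP; rewrite -subr_eq0 opprD addrACA; set z := x - y => /eqP z2.
(* Translating by [z] preserves the sum of all elements but adds [z *+ #|G|]. *)
have zG : z *+ #|G| = 0.
  have : \sum_(t : G) t = \sum_(t : G) (t + z).
    by rewrite [LHS](reindex_inj (addIr z)).
  by rewrite big_split /= sumr_const -[LHS]addr0 => /addrI.
apply/eqP; rewrite -subr_eq0 -/z -zG -(odd_double_half #|G|) oG mulrnDr mulr1n.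
by rewrite -mul2n mulrnA mulr2n z2 mul0rn addr0.
Qed.

Lemma length_fun0 (R : realFieldType) (G : finZmodType) : length_fun (fun=> 0 : R) (G := G).
Proof. by split=> *; rewrite ?addr0. Qed.

Lemma coverable0 (R : archiRealFieldType) (G : finZmodType) :
  coverable (fun=> 0 : R) (G := G).
Proof. by move=> M; exists (fun=> ord0) => *; rewrite invr_ge0. Qed.

(** Once [#|G|] is at least [K / c], a list of [K] elements has density at most [c]. *)
Lemma group_step (R : archiRealFieldType) (eta : R) (K : nat) :
  0 < eta -> eta <= 1 -> exists N0 : nat, forall (G : finZmodType) (A : pred G) (B : seq G),
    (N0 <= #|G|)%N -> odd #|G| -> (size B <= K)%N ->
    exists2 d, d \notin B &
    (#|A|%:R / #|G|%:R) ^+ 3 - eta <= #|ap3_pred A d|%:R / #|G|%:R.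
Proof.
move=> e0 e1; have [c c0 H] := popular_difference e0 e1.
exists (Num.bound (K%:R / c)) => G A B hN oG sB.
have [|d [dB _ hd]] := H G [set x | A x] (fun=> 0) (dbl_inj_odd oG)
  (length_fun0 _ _) (coverable0 _ _) [set x in B].
  rewrite /dens ler_pdivrMr ?ltr0n ?card_zmod_gt0 //.
  rewrite -ler_pdivrMl // mulrC; apply: (@le_trans _ _ (K%:R / c)).
    by rewrite ler_pM2r ?invr_gt0 // ler_nat cardsE (leq_trans (card_size _)).
  apply: le_trans (ltW (archi_boundP _)) _; first by rewrite divr_ge0 // ltW.
  by rewrite ler_nat.
exists d; first by rewrite inE in dB.
have cA : #|[set x | A x]| = #|A| by rewrite cardsE.
have cP : #|[set x | ap3_pred (mem [set x | A x]) d x]| = #|ap3_pred A d|.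
  by apply: eq_card => x; rewrite inE /ap3_pred /= !inE.
by move: hd; rewrite /dens cA cP.
Qed.

(** * The circle distance on a cyclic group *)

Section Cyclic.
Variables (R : archiRealFieldType) (m : nat).
Local Notation M := m.+2.
Local Notation ZM := 'I_m.+2.

Definition circle_norm (x : ZM) : nat := minn x (M - x).

Definition circle_length (x : ZM) : R := (circle_norm x)%:R / M%:R.

Lemma val_Zp_add (x y : ZM) : (x + y)%R = (if (x + y < M)%N then x + y else x + y - M)%N :> nat.
Proof.
have lx := ltn_ord x; have ly := ltn_ord y.
rewrite /=; case: ifP => h; first by rewrite modn_small.
have h' : (M <= x + y)%N by rewrite leqNgt h.
by rewrite -{1}(subnK h') modnDr modn_small //; lia.
Qed.

Lemma val_Zp_opp (x : ZM) : (- x)%R = (if (x : nat) == 0 then 0 else M - x)%N :> nat.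
Proof.
have lx := ltn_ord x; rewrite /=; case: eqP => [->|h]; first by rewrite subn0 modnn.
by rewrite modn_small //; lia.
Qed.

Lemma circle_length_fun : length_fun circle_length.
Proof.
have M0 : 0 < M%:R^-1 :> R by rewrite invr_gt0 ltr0n.
split=> [x|x|x y]; first by rewrite mulr_ge0 ?ler0n // ltW.
  congr (_%:R / _); rewrite /circle_norm val_Zp_opp; have lx := ltn_ord x.
  by case: ifP => /eqP; lia.
rewrite /circle_length -mulrDl ler_pM2r // -natrD ler_nat /circle_norm val_Zp_add.
have lx := ltn_ord x; have ly := ltn_ord y.
by case: ifP; lia.
Qed.

(** The colour of [x] is the index of its arc among [k.+1] equal arcs. *)
Lemma circle_length_coverable : coverable circle_length.
Proof.
move=> k; have colP (x : ZM) : (x * k.+1 %/ M < k.+1)%N.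
  by rewrite ltn_divLR // mulnC ltn_pmul2l.
exists (fun x => Ordinal (colP x)) => x y /(congr1 val) /= e.
have lx := ltn_ord x; have ly := ltn_ord y.
have cn : (circle_norm (x - y)%R * k.+1 <= M)%N.
  have le : (circle_norm (x - y)%R <= ((x : nat) - y) + ((y : nat) - x))%N.
    by rewrite /circle_norm val_Zp_add val_Zp_opp; case: ifP; case: ifP => /eqP; lia.
  apply: leq_trans (leq_mul le (leqnn _)) _.
  have := divn_eq (x * k.+1) M; have := divn_eq (y * k.+1) M; rewrite e.
  have := ltn_pmod (x * k.+1) (isT : (0 < M)%N).
  have := ltn_pmod (y * k.+1) (isT : (0 < M)%N).
  rewrite mulnDl !mulnBl; lia.
rewrite /circle_length ler_pdivrMr ?ltr0n // -(ler_pM2r (_ : 0 < k.+1%:R)) ?ltr0n //.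
by rewrite mulrAC mulVf ?pnatr_eq0 // mul1r -natrM ler_nat.
Qed.

Lemma card_ord_count (P : pred nat) : #|[set x : ZM | P x]| = count P (iota 0 M).
Proof.
by rewrite -sum1dep_card -(big_mkord P (fun=> 1%N)) sum1_count /index_iota subn0.
Qed.

End Cyclic.

(** * Transfer from a cyclic group to an interval of integers *)

Lemma int_range_nat (y : int) (n : nat) : 0 <= y -> y < n%:Z -> exists2 v : nat, y = v%:Z & (v < n)%N.
Proof. by case: y => // v _ h; exists v. Qed.

Definition int_count N (A : pred int) : nat := count A [seq n%:Z | n <- iota 1 N].

Definition int_supported N (A : pred int) : Prop := forall x : int, A x -> 1 <= x <= N%:Z.

Lemma int_count_shift N M (A : pred int) : int_supported N A -> (N <= M)%N ->
  count (fun v : nat => A (v%:Z + 1)) (iota 0 M) = int_count N A.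
Proof.
move=> sA NM; rewrite -(subnKC NM) iotaD count_cat add0n.
rewrite [X in (_ + X)%N](_ : _ = 0%N) ?addn0; last first.
  apply/eqP; rewrite -leqn0 leqNgt -has_count; apply/hasPn => v.
  by rewrite mem_iota => /andP[h _]; apply/negP => /sA; lia.
rewrite /int_count (iotaDl 1 0) -map_comp count_map; apply: eq_count => v /=.
by congr A; lia.
Qed.

Section Transfer.
Variables (m N : nat) (A : pred int).
Local Notation M := m.+2.
Local Notation ZM := 'I_m.+2.
Hypotheses (sA : int_supported N A) (NM : (N <= M)%N).

(* The residue [x], taken in [0, M), stands for the integer [x + 1]. *)
Let AG (x : ZM) := A ((x : nat)%:Z + 1).

Lemma card_transfer : #|[set x | AG x]| = int_count N A.
Proof. by rewrite (card_ord_count m (fun v => A (v%:Z + 1))); apply: int_count_shift. Qed.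

(** The representative of least absolute value, so that small circle norm gives a short integer
    difference. *)
Definition lift_int (d : ZM) : int :=
  if (d <= M - d)%N then d%:Z else d%:Z - M%:Z.

Lemma lift_intK (d : ZM) : (lift_int d)%:~R = d.
Proof.
have dE : (d : nat)%:R = d :> ZM by rewrite natr_Zp.
have M0 : M%:R = 0 :> ZM by apply: (pchar_Zp (isT : (1 < M)%N)).
by rewrite /lift_int; case: ifP => _; rewrite ?rmorphB /= -!pmulrn ?M0 ?subr0 dE.
Qed.

Lemma lift_int_norm d : `|lift_int d|%N = circle_norm d.
Proof.
rewrite /lift_int /circle_norm; have := ltn_ord d.
by case: ifP; lia.
Qed.

(** Only progressions starting within [2 * q] of either end can wrap around, and there are at most
    [4 * q] such starting points. *)
Lemma card_ap3_transfer (d : ZM) :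
  (#|[set x | ap3_pred (mem [set x | AG x]) d x]|
     <= int_count N (ap3_pred A (lift_int d)) + 4 * circle_norm d)%N.
Proof.
set e := lift_int d; set q := circle_norm d.
have sP : int_supported N (ap3_pred A e) by move=> x /and3P[/sA].
rewrite -(int_count_shift sP NM) -card_ord_count.
have val_add (x y : ZM) : y = x + d -> 0 <= (x : nat)%:Z + e < M%:Z ->
    (y : nat)%:Z = (x : nat)%:Z + e.
  move=> -> /andP[h1 h2]; have [v ev lv] := int_range_nat h1 h2.
  rewrite ev; congr Posz.
  have : (v%:R : ZM) = x + d.
    have xE : (x : nat)%:R = x :> ZM by rewrite natr_Zp.
    by rewrite -xE -(lift_intK d) -/e !pmulrn -intrD -ev.
  move=> <-; have := val_Zp_nat (isT : (1 < M)%N) v; rewrite modn_small //.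
set Q := [set x : ZM | _].
pose E := [set x : ZM | (x < 2 * q)%N || (M <= x + 2 * q)%N].
have QE : [set x | ap3_pred (mem [set x | AG x]) d x] \subset Q :|: E.
  apply/subsetP => x; rewrite !inE /ap3_pred /= !inE => /and3P[h1 h2 h3].
  case: (boolP ((x < 2 * q)%N || (M <= x + 2 * q)%N)); rewrite ?orbT // negb_or orbF.
  rewrite -leqNgt -ltnNge => /andP[lo hi].
  have eq : `|e|%N = q by apply: lift_int_norm.
  have v1 : ((x + d)%R : nat)%:Z = (x : nat)%:Z + e by apply: val_add => //; lia.
  have v2 : ((x + d + d)%R : nat)%:Z = (x : nat)%:Z + e + e.
    by rewrite -v1; apply: val_add => //; rewrite v1; lia.
  move: h1 h2 h3; rewrite /AG v1 v2.
  have -> : (x : nat)%:Z + 1 + e + e = (x : nat)%:Z + e + e + 1 by lia.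
  have -> : (x : nat)%:Z + 1 + e = (x : nat)%:Z + e + 1 by lia.
  by move=> -> -> ->.
have cE : (#|E| <= 4 * q)%N.
  rewrite (card_ord_count m (fun v => (v < 2 * q)%N || (M <= v + 2 * q)%N)).
  have cl (s : seq nat) (a : pred nat) b c : uniq s -> (forall v, v \in s -> a v -> v \in iota b c) -> (count a s <= c)%N.
    move=> us H; rewrite -size_filter -(size_iota b c); apply: uniq_leq_size.
      exact: filter_uniq.
    by move=> v; rewrite mem_filter => /andP[av vs]; apply: H.
  have -> : (4 * q = 2 * q + 2 * q)%N by lia.
  have cU (a b : pred nat) s : (count (predU a b) s <= count a s + count b s)%N.
    by rewrite -count_predUI leq_addr.
  apply: leq_trans (cU (fun v => v < 2 * q)%N (fun v => M <= v + 2 * q)%N _) _.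
  apply: leq_add; first apply: (cl _ _ 0%N) (iota_uniq _ _) _ => v.
    by rewrite !mem_iota; lia.
  apply: (cl _ _ (M - 2 * q)%N) (iota_uniq _ _) _ => v.
  by rewrite !mem_iota; lia.
apply: leq_trans (subset_leq_card QE) _; apply: leq_trans (leq_card_setU _ _) _.
by rewrite leq_add2l.
Qed.

End Transfer.

Lemma int_count_le N (A : pred int) : (int_count N A <= N)%N.
Proof. by rewrite -[leqRHS](size_iota 1) -(size_map Posz) count_size. Qed.

Lemma int_step (R : archiRealFieldType) (eta : R) (K : nat) :
  0 < eta -> eta <= 1 -> exists N0 : nat, forall N (A : pred int) (B : seq int),
    (N0 <= N)%N -> int_supported N A -> (size B <= K)%N ->
    exists2 d, d \notin B &
    ((int_count N A)%:R / N%:R) ^+ 3 - eta <= (int_count N (ap3_pred A d))%:R / N%:R.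
Proof.
(* The eight parts of [eta]: one for the cyclic theorem, four for wraparound, three for changing the
   modulus. *)
move=> e0 e1; pose h := eta / 8.
have h0 : 0 < h by rewrite divr_gt0.
have h1 : h <= 1 by rewrite /h; lra.
have [c c0 H] := popular_difference h0 h1.
exists (3 + Num.bound (K%:R / c) + Num.bound h^-1)%N => N A B hN sA sB.
have [N3 NK Nh] : [/\ (3 <= N)%N, (Num.bound (K%:R / c) <= N)%N & (Num.bound h^-1 <= N)%N].
  split; apply: leq_trans hN; rewrite -?addnA ?leq_addr //.
    by rewrite addnCA leq_addr.
  by rewrite addnA leq_addl.
(* [m.+2] is the odd one of [N] and [N.+1]. *)
have [m [mo Nm mN]] : exists m, [/\ odd m, (N <= m.+2)%N & (m.+2 <= N.+1)%N].
  by exists ((if odd N then N else N.+1) - 2)%N; clear -N3; case: ifP; split; lia.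
pose G := ('I_m.+2 : finZmodType).
pose AG := [set x : G | A ((x : nat)%:Z + 1)].
have oG : odd #|G| by rewrite card_ord /= negbK.
have NR : 0 < N%:R :> R by rewrite ltr0n (leq_trans _ N3).
have MR : 0 < m.+2%:R :> R by rewrite ltr0n.
have NMR : N%:R <= m.+2%:R :> R by rewrite ler_nat.
have [|d [dB dl hd]] := H G AG (@circle_length R m) (dbl_inj_odd oG)
   (@circle_length_fun R m) (@circle_length_coverable R m) [set x in [seq z%:~R | z <- B]].
  rewrite /dens ler_pdivrMr ?card_ord // -ler_pdivrMl // mulrC.
  apply: (@le_trans _ _ (K%:R / c)).
    rewrite ler_pM2r ?invr_gt0 // ler_nat cardsE (leq_trans (card_size _)) //.
    by rewrite size_map.
  apply: le_trans (ltW (archi_boundP _)) _; first by rewrite divr_ge0 // ltW.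
  by rewrite ler_nat (leq_trans NK).
(* The residues of [B] were excluded, and [lift_int d] reduces to [d]. *)
exists (lift_int d).
  by apply: contra dB => eB; rewrite inE; apply/mapP; exists (lift_int d); rewrite ?lift_intK.
have := card_ap3_transfer sA Nm d; rewrite -/AG; set p := #|_|; set q := int_count _ _ => pq.
have hp : (#|AG|%:R / m.+2%:R) ^+ 3 - h <= p%:R / m.+2%:R.
  by move: hd; rewrite /dens card_ord.
rewrite /AG (card_transfer sA Nm) in hp; set n := int_count N A in hp *.
have nN : n%:R <= N%:R :> R by rewrite ler_nat int_count_le.
have qM : q%:R / m.+2%:R <= q%:R / N%:R :> R.
  by rewrite ler_wpM2l ?ler0n // lef_pV2.
have pqR : p%:R / m.+2%:R <= q%:R / m.+2%:R + 4 * h.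
  apply: (@le_trans _ _ ((q + 4 * circle_norm d)%:R / m.+2%:R)).
    by rewrite ler_pM2r ?invr_gt0 // ler_nat.
  rewrite natrD natrM mulrDl lerD2l -mulrA ler_pM2l //.
have hN1 : N%:R^-1 <= h.
  rewrite invf_ple ?posrE //; apply: le_trans (ltW (archi_boundP _)) _.
    by rewrite invr_ge0 ltW.
  by rewrite ler_nat.
set a := n%:R / N%:R; set b := n%:R / m.+2%:R in hp.
have a0 : 0 <= a by rewrite divr_ge0.
have b0 : 0 <= b by rewrite divr_ge0.
have ba : b <= a by rewrite ler_wpM2l ?ler0n // lef_pV2.
have a1 : a <= 1 by rewrite ler_pdivrMr // mul1r.
have ab : a - b <= h.
  apply: le_trans hN1; have -> : a - b = b * (m.+2%:R - N%:R) / N%:R.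
    by rewrite /a /b; field; apply/andP; split; [rewrite gt_eqF | rewrite -natrD pnatr_eq0].
  rewrite -[leRHS]mul1r ler_pM2r ?invr_gt0 // mulr_ile1 //; first by rewrite subr_ge0.
    exact: le_trans ba a1.
  by rewrite lerBlDr addrC natr1 ler_nat.
have : a ^+ 3 - b ^+ 3 <= 3 * h.
  by apply: sub_cube_le; rewrite ?a0 ?b0 ?(le_trans ba a1) // ltW.
have -> : eta = 8 * h by rewrite /h; lra.
move: hp pqR qM; move: (p%:R / _) (q%:R / m.+2%:R) (q%:R / N%:R) (a ^+ 3) (b ^+ 3).
by move=> u v t x y; lra.
Qed.

Theorem theorem21 (R : archiRealFieldType) (eps : R) (r : nat) :
  0 < eps -> (0 < r)%N ->
  exists N0 : nat, (0 < N0)%N /\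
  forall N : nat, (N0 <= N)%N ->
    (* case G an abelian group of odd order N *)
    (forall (G : finZmodType) (A : {set G}),
       #|G| = N -> odd N ->
       exists d : 'I_r -> G,
         proper_box d /\
         ((#|A|%:R / N%:R) ^+ (3 ^ r) - eps) * N%:R
           <= #|[set a0 : G | box_in d (mem A) a0]|%:R)
    /\
    (* case G = [N] = {1,...,N}, boxes computed in Z *)
    (forall A : pred int,
       (forall x : int, A x -> (1 <= x <= N%:Z)%R) ->
       exists d : 'I_r -> int,
         proper_box d /\
         (((count A [seq n%:Z | n <- iota 1 N])%:R / N%:R) ^+ (3 ^ r) - eps) * N%:R
           <= (count (box_in d A) [seq n%:Z | n <- iota 1 N])%:R).
Proof.
(* The induction multiplies the error by [4 ^+ r]; the minimum with 1 ensures [eta <= 1]. *)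
move=> e0 _; pose eta := Num.min eps 1 / 4 ^+ r.
have p4 : 0 < 4 ^+ r :> R by rewrite exprn_gt0.
have eta0 : 0 < eta by rewrite divr_gt0 // lt_min e0 ltr01.
have eta1 : eta <= 1.
  rewrite ler_pdivrMr // mul1r; apply: (@le_trans _ _ 1); first by rewrite ge_min lexx orbT.
  by rewrite exprn_ege1 // ler1n.
have eta_eps : 4 ^+ r * eta <= eps by rewrite mulrC divfK ?gt_eqF // ge_min lexx.
have [N1 H1] := group_step (2 * 9 ^ r) eta0 eta1.
have [N2 H2] := int_step (2 * 9 ^ r) eta0 eta1.
exists (N1 + N2).+1; split=> // N hN.
have N0 : (0 < N)%N by apply: leq_trans hN.
have NR : 0 < N%:R :> R by rewrite ltr0n.
have fin (a b : R) : a - 4 ^+ r * eta <= b / N%:R -> (a - eps) * N%:R <= b.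
  by move=> h; rewrite -ler_pdivlMr //; lra.
split=> [G A cG oN|A sA].
  have oG : odd #|G| by rewrite cG.
  (* Halving is the inverse of doubling, a bijection in odd order. *)
  have [||||d [dp dA]] := @box_induction R G (fun P => #|P|) (fun=> True)
    (invF (dbl_inj_odd oG)) N (2 * 9 ^ r)%N eta N0 (ltW eta0)
    (invF_f (dbl_inj_odd oG)) _ _ _ _ r (mem A) I (leqnn _).
  - by move=> P; rewrite -cG max_card.
  - by move=> P Q PQ; apply: eq_card.
  - by [].
  - by move=> P B _ sB; rewrite -cG; apply: H1 => //; rewrite cG (leq_trans _ hN) // leqW // leq_addr.
  - by exists d; split=> //; apply: fin; move: dA; rewrite cardsE.
have halfK (x : int) : ((x + x) %/ 2)%Z = x by lia.
have [||||d [dp dA]] := @box_induction R int (int_count N) (int_supported N)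
    (fun x => (x %/ 2)%Z) N (2 * 9 ^ r)%N eta N0 (ltW eta0) halfK
    _ _ _ _ r A sA (leqnn _).
- exact: int_count_le.
- by move=> P Q PQ; apply: eq_count.
- by move=> P Q sP QP x /QP /sP.
- by move=> P B sP sB; apply: H2 => //; rewrite (leq_trans _ hN) // leqW // leq_addl.
- by exists d; split=> //; apply: fin.
Qed.
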